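(* Let $X_{\tilde n}^{(k)}$ be an affine Kac–Moody algebra over $\mathbb Q$ and $\mathcal U$ its universal enveloping algebra. Let $\mathcal U_{\mathbb Z}^{K.M.}$ be the $\mathbb Z$-subalgebra of $\mathcal U$ generated by the divided powers $e_i^{(m)},f_i^{(m)}$ ($i\in\{0,\dots,n\}$, $m\in\mathbb N$) of the Kac–Moody generators, and let $\mathcal U_{\mathbb Z}$ be the $\mathbb Z$-subalgebra of $\mathcal U$ generated by the divided powers $(x_{i,r}^+)^{(m)},(x_{i,r}^-)^{(m)}$ ($i\in\{1,\dots,n\}$, $\tilde d_i\mid r\in\mathbb Z$, $m\in\mathbb N$) of the Drinfeld generators. 1. If $X_{\tilde n}^{(k)}$ is not of type $A_{2n}^{(2)}$, then $\mathcal U_{\mathbb Z}$ and $\mathcal U_{\mathbb Z}^{K.M.}$ are isomorphic; precisely, they coincide under the identification of the two presentations of $X_{\tilde n}^{(k)}$. 2. If $X_{\tilde n}^{(k)}=A_{2n}^{(2)}$, then $\mathcal U_{\mathbb Z}\subseteq\mathcal U_{\mathbb Z}^{K.M.}$.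
   Context: Divided powers: $y^{(m)}=y^m/m!$. Let $A=(a_{i,j})_{i,j\in\{0,\dots,n\}}$ be the affine Cartan matrix of type $X_{\tilde n}^{(k)}$, $D=\mathrm{diag}(d_i)$ the diagonal matrix symmetrizing $A$ with $\min_id_i=1$, and $M=\max_id_i$. In type $A_{2n}^{(2)}$ the nodes are labelled so that $d_1=1$, $d_i=2$ for $1<i\le n$, $d_0=4$. Kac–Moody presentation: $X_{\tilde n}^{(k)}$ is the Lie algebra generated by $e_i,f_i,h_i$ ($0\le i\le n$) with commuting $h_i$ and $[e_i,f_j]=\delta_{i,j}h_i$, $[h_i,e_j]=a_{i,j}e_j$, $[h_i,f_j]=-a_{i,j}f_j$, $(\mathrm{ad}\,e_i)^{1-a_{i,j}}(e_j)=0=(\mathrm{ad}\,f_i)^{1-a_{i,j}}(f_j)$ for $i\neq j$. Loop (Drinfeld) presentation: put $\tilde d_i=1$ if $k=1$ or $X_{\tilde n}^{(k)}=A_{2n}^{(2)}$, and $\tilde d_i=d_i$ otherwise; $a_{i,j;r}=2(2+(-1)^{r-1})$ if $X_{\tilde n}^{(k)}=A_{2n}^{(2)}$, $i=j$, $d_i=1$, and $a_{i,j;r}=a_{i,j}$ otherwise. $X_{\tilde n}^{(k)}$ is generated by $c$, $x_{i,r}^\pm$, $h_{i,r}$ ($1\le i\le n$, $r\in\mathbb Z$ with $\tilde d_i\mid r$; by convention a symbol with index $i$ and degree not divisible by $\tilde d_i$ is $0$) with relations: $c$ central; $[h_{i,r},h_{j,s}]=r\delta_{r+s,0}\frac{a_{i,j;r}}{d_j}Mc$;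 $[x_{i,r}^+,x_{j,s}^-]=\delta_{i,j}\left(h_{i,r+s}+r\delta_{r+s,0}\frac{Mc}{d_j}\right)$; $[h_{i,r},x_{j,s}^\pm]=\pm a_{i,j;r}x_{j,r+s}^\pm$; $[x_{i,r}^\pm,x_{i,s}^\pm]=0$ if $(X_{\tilde n}^{(k)},d_i)\ne(A_{2n}^{(2)},1)$ or $r+s$ is even; $[x_{i,r}^\pm,x_{i,s}^\pm]+[x_{i,r+1}^\pm,x_{i,s-1}^\pm]=0$ if $(X_{\tilde n}^{(k)},d_i)=(A_{2n}^{(2)},1)$ and $r+s$ is odd; $[x_{1,r}^\pm,[x_{1,s}^\pm,x_{1,t}^\pm]]=0$; $(\mathrm{ad}\,x_{i,r}^\pm)^{1-a_{i,j}}(x_{j,s}^\pm)=0$ for $i\ne j$. Identification of the two presentations: let $\Phi_0$ be the root system of the finite-type simple Lie algebra with Cartan matrix $(a_{i,j})_{1\le i,j\le n}$ and simple roots $\alpha_1,\dots,\alpha_n$; let $\theta\in\Phi_0$ be the highest root if $k=1$ and the highest short root if $k\neq1$. For $1\le i\le n$ let $\tau_i=\exp(\mathrm{ad}\,x_{i,0}^+)\exp(-\mathrm{ad}\,x_{i,0}^-)\exp(\mathrm{ad}\,x_{i,0}^+)$. Choose simple reflections $\sigma_{i_1},\dots,\sigma_{i_l}$ and $j$ with $\theta=\sigma_{i_1}\cdots\sigma_{i_l}(\alpha_j)$ (with $j=1$ in type $A_{2n}^{(2)}$) and put $x_{\theta,r}^\pm=\tau_{i_1}\cdots\tau_{i_l}(x_{j,r}^\pm)$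 and, in type $A_{2n}^{(2)}$, for $r$ odd, $X_{\theta,r}^\pm=\tau_{i_1}\cdots\tau_{i_l}([x_{1,0}^\pm,x_{1,r}^\pm])$. Then $e_i=x_{i,0}^+$, $f_i=x_{i,0}^-$ for $1\le i\le n$, while $e_0=x_{\theta,1}^-$, $f_0=x_{\theta,-1}^+$ if the type is not $A_{2n}^{(2)}$, and $e_0=\pm\frac14X_{\theta,1}^-$, $f_0=\pm\frac14X_{\theta,-1}^+$ (signs chosen so that $e_0,f_0,[e_0,f_0]$ satisfy the Kac–Moody relations) in type $A_{2n}^{(2)}$. *)

(* Defs.v *)
From HB Require Import structures.
From mathcomp Require Import all_boot all_order all_algebra.
From mathcomp Require Import boolp classical_sets cardinality fsbigop.

Set Implicit Arguments.
Unset Strict Implicit.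
Unset Printing Implicit Defensive.

Import GRing.Theory.
Local Open Scope classical_set_scope.
Local Open Scope ring_scope.

HB.mixin Record Lmodule_isLieAlgebra (R : pzRingType) L of GRing.Lmodule R L := {
  lie : L -> L -> L;
  lie_linearl : forall y, linear (lie^~ y);
  lie_linearr : forall x, linear (lie x);
  liexx : forall x, lie x x = 0;
  lie_jacobi : forall x y z,
    lie x (lie y z) + lie y (lie z x) + lie z (lie x y) = 0
}.

#[short(type="lieAlgType")]
HB.structure Definition LieAlgebra (R : pzRingType) :=
  { L of Lmodule_isLieAlgebra R L & GRing.Lmodule R L }.

Reserved Notation "⟦ x , y ⟧" (format "⟦ x ,  y ⟧").
Notation "⟦ x , y ⟧" := (lie x y) : ring_scope.

Definition lie_hom (L L' : lieAlgType rat) (f : L -> L') : Prop :=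
  linear f /\ forall x y, f ⟦x, y⟧ = ⟦f x, f y⟧.

(* [rel L' g'] states the defining relations for a family [g'] of elements of
   [L'].  Only equations between Lie words in the generators may be used: the
   centrality of a generator, for instance, must be expressed against the other
   generators and not against the whole of [L']. *)
Definition presents (G : Type) (rel : forall L' : lieAlgType rat, (G -> L') -> Prop)
    (L : lieAlgType rat) (g : G -> L) : Prop :=
  rel L g /\
  forall (L' : lieAlgType rat) (g' : G -> L'), rel L' g' ->
    (exists f : L -> L', lie_hom f /\ forall a, f (g a) = g' a) /\
    (forall f1 f2 : L -> L', lie_hom f1 -> lie_hom f2 ->
       (forall a, f1 (g a) = f2 (g a)) -> forall x, f1 x = f2 x).

Definition lie_to_alg_hom (L : lieAlgType rat) (U : algType rat) (f : L -> U) : Prop :=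
  linear f /\ forall x y, f ⟦x, y⟧ = f x * f y - f y * f x.

Definition is_enveloping (L : lieAlgType rat) (U : algType rat) (iota : L -> U) : Prop :=
  lie_to_alg_hom iota /\
  forall (B : algType rat) (j : L -> B), lie_to_alg_hom j ->
    (exists f : {lrmorphism U -> B}, forall x, f (iota x) = j x) /\
    (forall f1 f2 : {lrmorphism U -> B},
       (forall x, f1 (iota x) = f2 (iota x)) -> forall u, f1 u = f2 u).

Definition divpow (U : algType rat) (y : U) (m : nat) : U :=
  (m`!%:R)^-1 *: y ^+ m.

Definition gen_zsubalg (U : algType rat) (S : set U) : set U :=
  smallest (fun B : set U => subring_closed [in B]) S.

(* The sum ranges over the finitely many m with (ad x)^m y != 0; it is the
   exponential when ad x is locally nilpotent, the only case of interest. *)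
Definition exp_ad (L : lieAlgType rat) (x y : L) : L :=
  \sum_(m \in [set: nat]) (m`!%:R)^-1 *: iter m (lie x) y.

(* In Kac's notation: A1 n = A_n^(1), B1 n = B_n^(1), C1 n = C_n^(1),
   D1 n = D_n^(1), E61 = E_6^(1), E71 = E_7^(1), E81 = E_8^(1), F1 = F_4^(1),
   G1 = G_2^(1), A2even n = A_{2n}^(2), A2odd n = A_{2n-1}^(2),
   D2 n = D_{n+1}^(2), E2 = E_6^(2), D3 = D_4^(3). *)
Inductive affine_type :=
  | A1 of nat | B1 of nat | C1 of nat | D1 of nat
  | E61 | E71 | E81 | F1 | G1
  | A2even of nat | A2odd of nat | D2 of nat | E2 | D3.

Definition affine_ok (X : affine_type) : bool :=
  match X with
  | A1 n => (1 <= n)%N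
  | B1 n => (3 <= n)%N
  | C1 n => (2 <= n)%N
  | D1 n => (4 <= n)%N
  | A2even n => (1 <= n)%N
  | A2odd n => (3 <= n)%N
  | D2 n => (2 <= n)%N
  | _ => true
  end.

(* The nodes of the Dynkin diagram are 0, ..., rank X. *)
Definition rank (X : affine_type) : nat :=
  match X with
  | A1 n | B1 n | C1 n | D1 n | A2even n | A2odd n | D2 n => n
  | E61 => 6 | E71 => 7 | E81 => 8 | F1 => 4 | G1 => 2
  | E2 => 4 | D3 => 2
  end.

(* The superscript k. *)
Definition twist (X : affine_type) : nat :=
  match X with
  | A2even _ | A2odd _ | D2 _ | E2 => 2
  | D3 => 3
  | _ => 1
  end.

Definition is_A2even (X : affine_type) : bool :=
  if X is A2even _ then true else false.

(* A quadruple (i, j, p, q) means a_{i,j} = - p and a_{j,i} = - q. *)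
Definition simple_edge (i j : nat) := [:: (i, j, 1%N, 1%N)].

(* The arrow points from i to j: i is long and j is short. *)
Definition arrow (m i j : nat) := [:: (i, j, 1%N, m)].

Definition chain (a b : nat) := flatten [seq simple_edge k k.+1 | k <- iota a (b - a)].

(* Kac's labelling, except for A_{2n}^(2), whose linear diagram is labelled
   1, 2, ..., n, 0 from its shortest to its longest root. *)
Definition dynkin (X : affine_type) : seq (nat * nat * nat * nat) :=
  match X with
  | A1 n => if n == 1%N then [:: (0, 1, 2, 2)%N] else chain 0 n ++ simple_edge n 0
  | B1 n => simple_edge 0 2 ++ chain 1 n.-1 ++ arrow 2 n.-1 n
  | C1 n => arrow 2 0 1 ++ chain 1 n.-1 ++ arrow 2 n n.-1
  | D1 n => simple_edge 0 2 ++ chain 1 n.-1 ++ simple_edge n.-2 n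
  | E61 => chain 1 5 ++ simple_edge 3 6 ++ simple_edge 6 0
  | E71 => chain 0 6 ++ simple_edge 3 7
  | E81 => chain 0 7 ++ simple_edge 5 8
  | F1 => chain 0 2 ++ arrow 2 2 3 ++ simple_edge 3 4
  | G1 => simple_edge 0 1 ++ arrow 3 1 2
  | A2even n =>
      if n == 1%N then arrow 4 0 1 else arrow 2 2 1 ++ chain 2 n ++ arrow 2 0 n
  | A2odd n => simple_edge 0 2 ++ chain 1 n.-1 ++ arrow 2 n n.-1
  | D2 n => arrow 2 1 0 ++ chain 1 n.-1 ++ arrow 2 n.-1 n
  | E2 => chain 0 2 ++ arrow 2 3 2 ++ simple_edge 3 4
  | D3 => simple_edge 0 1 ++ arrow 3 2 1
  end.

(* No unordered pair of nodes occurs twice in [dynkin X], so the sum has at most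
   one nonzero term. *)
Definition cartan (X : affine_type) : 'M[int]_((rank X).+1) :=
  \matrix_(i, j)
    if i == j then 2
    else - (\sum_(b <- dynkin X)
              let: (k, l, p, q) := b in
              ((k == i) && (l == j)) * p + ((k == j) && (l == i)) * q)%N%:Z.

Definition min_symmetrizer n (A : 'M[int]_n) (d : 'I_n -> nat) : Prop :=
  [/\ forall i j, (d i)%:Z * A i j = (d j)%:Z * A j i,
      forall i, (1 <= d i)%N
    & exists i, d i = 1%N].

Definition max_sym n (d : 'I_n -> nat) : nat := \max_i d i.

(* Elements of 'I_n index the nodes 1, ..., n of the finite diagram: i : 'I_n
   is the node [fnode i] of value i + 1. *)
Definition fnode n (i : 'I_n) : 'I_n.+1 := lift ord0 i.

Inductive km_gen (n : nat) := KMe of 'I_n.+1 | KMf of 'I_n.+1 | KMh of 'I_n.+1.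

Definition km_relations (X : affine_type) (L : lieAlgType rat)
    (g : km_gen (rank X) -> L) : Prop :=
  let e i := g (KMe i) in let f i := g (KMf i) in let h i := g (KMh i) in
  let A := cartan X in
  [/\ forall i j, ⟦h i, h j⟧ = 0,
      forall i j, ⟦e i, f j⟧ = if i == j then h i else 0,
      forall i j, ⟦h i, e j⟧ = (A i j)%:~R *: e j,
      forall i j, ⟦h i, f j⟧ = - (A i j)%:~R *: f j
    & forall i j : 'I_(rank X).+1, i != j ->
        iter `|1 - A i j|%N (lie (e i)) (e j) = 0 /\
        iter `|1 - A i j|%N (lie (f i)) (f j) = 0].

(* [Dx s i r] is x_{i,r}^+ for s = false and x_{i,r}^- for s = true, so that
   (-1) ^+ s is the sign. *)
Inductive drinfeld_gen (n : nat) :=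
  | Dc
  | Dx of bool & 'I_n & int
  | Dh of 'I_n & int.
Arguments Dc {n}.

Definition dtilde (X : affine_type) (d : 'I_(rank X).+1 -> nat)
    (i : 'I_(rank X)) : nat :=
  if (twist X == 1%N) || is_A2even X then 1%N else d (fnode i).

Definition drinfeld_deg (X : affine_type) (d : 'I_(rank X).+1 -> nat)
    (i : 'I_(rank X)) (r : int) : bool :=
  ((dtilde d i)%:Z %| r)%Z.

Definition special_node (X : affine_type) (d : 'I_(rank X).+1 -> nat)
    (i : 'I_(rank X)) : bool :=
  is_A2even X && (d (fnode i) == 1%N).

Definition loop_cartan (X : affine_type) (d : 'I_(rank X).+1 -> nat)
    (i j : 'I_(rank X)) (r : int) : int :=
  if special_node d i && (i == j) then 2 * (2 + (-1) ^ (r - 1))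
  else cartan X (fnode i) (fnode j).

(* The symbols of forbidden degree vanish, and a relation is imposed only when
   the symbols bracketed in its left-hand side have admissible degrees; on the
   right-hand sides a symbol of forbidden degree is read as 0. *)
Definition drinfeld_relations (X : affine_type) (d : 'I_(rank X).+1 -> nat)
    (L : lieAlgType rat) (y : drinfeld_gen (rank X) -> L) : Prop :=
  let c := y Dc in
  let x s i r := y (Dx s i r) in
  let h i r := y (Dh i r) in
  let M : rat := (max_sym d)%:R in
  let dd i : rat := (d (fnode i))%:R in
  let adm := drinfeld_deg d in
  (forall s i r, ~~ adm i r -> x s i r = 0) /\
  (forall i r, ~~ adm i r -> h i r = 0) /\
  (forall s i r, ⟦c, x s i r⟧ = 0) /\
  (forall i r, ⟦c, h i r⟧ = 0) /\
  (forall i j r s, adm i r -> adm j s ->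
     ⟦h i r, h j s⟧ =
       if r + s == 0
       then (r%:~R * (loop_cartan d i j r)%:~R / dd j * M) *: c else 0) /\
  (forall i j r s, adm i r -> adm j s ->
     ⟦x false i r, x true j s⟧ =
       if i == j
       then h i (r + s) + (if r + s == 0 then (r%:~R * M / dd j) *: c else 0)
       else 0) /\
  (forall u i j r s, adm i r -> adm j s ->
     ⟦h i r, x u j s⟧ = ((-1) ^+ u * (loop_cartan d i j r)%:~R) *: x u j (r + s)) /\
  (forall u i r s, adm i r -> adm i s ->
     ~~ special_node d i || (2 %| r + s)%Z -> ⟦x u i r, x u i s⟧ = 0) /\
  (forall u i r s, adm i r -> adm i s ->
     special_node d i -> ~~ (2 %| r + s)%Z ->
     ⟦x u i r, x u i s⟧ + ⟦x u i (r + 1), x u i (s - 1)⟧ = 0) /\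
  (forall u i r s t, fnode i = 1%N :> nat -> adm i r -> adm i s -> adm i t ->
     ⟦x u i r, ⟦x u i s, x u i t⟧⟧ = 0) /\
  (forall u (i j : 'I_(rank X)) r s, i != j -> adm i r -> adm j s ->
     iter `|1 - cartan X (fnode i) (fnode j)|%N (lie (x u i r)) (x u j s) = 0).

(* Roots are written in coordinates with respect to the simple roots;
   sigma_i(beta) = beta - <beta, alpha_i^vee> alpha_i with
   <alpha_j, alpha_i^vee> = a_{i,j}. *)
Definition simple_root n (i : 'I_n) : 'rV[int]_n := delta_mx 0 i.

Definition simple_refl (X : affine_type) (i : 'I_(rank X))
    (b : 'rV[int]_(rank X)) : 'rV[int]_(rank X) :=
  b - (\sum_j b 0 j * cartan X (fnode i) (fnode j)) *: simple_root i.

(* Every root is Weyl conjugate to a simple root. *)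
Definition fin_roots (X : affine_type) : set 'rV[int]_(rank X) :=
  [set b | exists (w : seq 'I_(rank X)) (j : 'I_(rank X)),
             b = foldr (@simple_refl X) (simple_root j) w].
Arguments fin_roots : clear implicits.

(* (alpha_i, alpha_j) = d_i a_{i,j}. *)
Definition root_norm (X : affine_type) (d : 'I_(rank X).+1 -> nat)
    (b : 'rV[int]_(rank X)) : int :=
  \sum_i \sum_j (d (fnode i))%:Z * cartan X (fnode i) (fnode j) * b 0 i * b 0 j.

(* When all roots have the same length they are all short. *)
Definition short_roots (X : affine_type) (d : 'I_(rank X).+1 -> nat) :
    set 'rV[int]_(rank X) :=
  [set b | fin_roots X b /\
           forall b', fin_roots X b' -> root_norm d b <= root_norm d b'].

Definition highest_in n (S : set 'rV[int]_n) (t : 'rV[int]_n) : Prop :=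
  S t /\ forall b, S b -> forall i, b 0 i <= t 0 i.

Definition is_theta (X : affine_type) (d : 'I_(rank X).+1 -> nat)
    (t : 'rV[int]_(rank X)) : Prop :=
  highest_in (if twist X == 1%N then fin_roots X else short_roots d) t.

Definition tau n (L : lieAlgType rat) (y : drinfeld_gen n -> L) (i : 'I_n)
    (z : L) : L :=
  exp_ad (y (Dx false i 0)) (exp_ad (- y (Dx true i 0)) (exp_ad (y (Dx false i 0)) z)).

Definition x_theta n (L : lieAlgType rat) (y : drinfeld_gen n -> L)
    (w : seq 'I_n) (j : 'I_n) (s : bool) (r : int) : L :=
  foldr (tau y) (y (Dx s j r)) w.

(* Used only for j the node 1 and r odd. *)
Definition X_theta n (L : lieAlgType rat) (y : drinfeld_gen n -> L)
    (w : seq 'I_n) (j : 'I_n) (s : bool) (r : int) : L :=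
  foldr (tau y) ⟦y (Dx s j 0), y (Dx s j r)⟧ w.

Definition identified (X : affine_type) (L : lieAlgType rat)
    (g : km_gen (rank X) -> L) (y : drinfeld_gen (rank X) -> L)
    (w : seq 'I_(rank X)) (j : 'I_(rank X)) : Prop :=
  [/\ forall i, g (KMe (fnode i)) = y (Dx false i 0),
      forall i, g (KMf (fnode i)) = y (Dx true i 0)
    & if is_A2even X then
        exists s1 s2 : bool,
          g (KMe ord0) = ((-1) ^+ s1 / 4) *: X_theta y w j true 1 /\
          g (KMf ord0) = ((-1) ^+ s2 / 4) *: X_theta y w j false (-1)
      else
        g (KMe ord0) = x_theta y w j true 1 /\
        g (KMf ord0) = x_theta y w j false (-1)].

Definition UZ_KM n (L : lieAlgType rat) (U : algType rat) (iota : L -> U)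
    (g : km_gen n -> L) : set U :=
  gen_zsubalg [set u | exists (i : 'I_n.+1) (m : nat),
    u = divpow (iota (g (KMe i))) m \/ u = divpow (iota (g (KMf i))) m].

Definition UZ_Drinfeld (X : affine_type) (d : 'I_(rank X).+1 -> nat)
    (L : lieAlgType rat) (U : algType rat) (iota : L -> U)
    (y : drinfeld_gen (rank X) -> L) : set U :=
  gen_zsubalg [set u | exists (s : bool) (i : 'I_(rank X)) (r : int) (m : nat),
    drinfeld_deg d i r /\ u = divpow (iota (y (Dx s i r))) m].

(* Main.v *)
From HB Require Import structures.
Require Import Defs.
From mathcomp Require Import all_boot all_order all_algebra.
From mathcomp Require Import boolp classical_sets cardinality fsbigop.
From mathcomp Require Import ring lra zify.

(** Call z in L integral (for a subring B of U) when all its divided powers lie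
    in B.  If x and z are integral then so is exp(ad x)(z): its divided powers
    are sums of x^(a) z^(k) (-x)^(b).  Hence integral elements are stable under
    the sl2 reflections exp(-ad F) exp(ad E) with E, F integral.

    The Drinfeld form contains e_0 and f_0 because these are obtained from
    x_{j,1}^- and x_{j,-1}^+ by the tau_i.  Conversely, for the Kac-Moody form,
    undoing the tau_i shows that x_{j,1}^- and x_{j,-1}^+ are integral; the
    reflections in the affine sl2 attached to j then reach all the x_{j,r}.  If
    i is adjacent to j, the reflections in alpha_j + r delta and in alpha_j
    compose to a translation, x_{i,s} -> x_{i, s - a_{ji} r}, which carries
    integrality from j to i as soon as a_{ji} generates the right lattice of
    degrees: when i is not longer than j in the untwisted case, and not shorter
    in the twisted case.  This works because theta, hence alpha_j, is long,
    resp. short.  In type A_{2n}^(2) the roots 2 alpha_1 + r delta, r odd, take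
    the place of the multiples of delta in leaving node 1. *)

Set Implicit Arguments.
Unset Strict Implicit.
Unset Printing Implicit Defensive.

Import Order.TTheory GRing.Theory Num.Theory.
Local Open Scope classical_set_scope.
Local Open Scope ring_scope.

(** * Finite sums behind products of exponential series *)

Lemma sum_antidiag (V : nmodType) (F : nat -> nat -> V) N :
  (forall a b, (N <= a + b)%N -> F a b = 0) ->
  \sum_(a < N) \sum_(b < N) F a b = \sum_(m < N) \sum_(a < m.+1) F a (m - a)%N.
Proof.
move=> F0; rewrite (eq_bigr (fun a : 'I_N => \sum_(m < N | (a <= m)%N) F a (m - a)%N)).
  rewrite (exchange_big_dep xpredT) //=; apply: eq_bigr => m _.
  rewrite (big_ord_widen N (fun a => F a (m - a)%N)) //.
move=> a _; rewrite -[RHS](big_geq_mkord a N xpredT (fun m => F a (m - a)%N)).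
rewrite -{2}[val a]add0n big_addn -(big_mkord xpredT (F a)).
rewrite [LHS](@big_cat_nat _ _ _ (N - a)) ?leq_subr //=.
(* From b = N - a on, the terms of the square lie outside the triangle a + b < N, where F
   vanishes. *)
have -> : \sum_(N - a <= b < N) F a b = 0.
  by rewrite big_nat big1 // => b /andP[+ _]; rewrite leq_subLR; apply: F0.
rewrite addr0.
by apply: eq_bigr => b _; rewrite addnK.
Qed.

(** Coefficient of t^m in exp(-t) exp(t) = 1; multiplied by m!, the sum is the binomial expansion of
    (1 - 1)^m. *)
Lemma sum_alternating_binomial m :
  \sum_(a < m.+1) ((-1) ^+ a / a`!%:R) * ((m - a)`!%:R)^-1 = (m == 0%N)%:R :> rat.
Proof.
have fN (k : nat) : k`!%:R != 0 :> rat by rewrite pnatr_eq0 -lt0n fact_gt0.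
have -> : (m == 0%N)%:R = (1 + -1) ^+ m / m`!%:R :> rat.
  by rewrite subrr expr0n; case: m => [|m] /=; rewrite ?mul0r // divr1.
rewrite exprDn mulr_suml; apply: eq_bigr => -[a /= am] _.
rewrite expr1n mul1r -mulr_natr; move: ((-1) ^+ a : rat) => c.
rewrite -(bin_fact (am : (a <= m)%N)) !natrM.
have := fN a; have := fN (m - a)%N.
have : 'C(m, a)%:R != 0 :> rat by rewrite pnatr_eq0 -lt0n bin_gt0.
by move=> c0 b0 a0; field; rewrite a0 b0 c0.
Qed.

(** * Lie algebras and exponentials *)

Section LieTheory.
Variable L : lieAlgType rat.
Implicit Types (a b x y z : L) (k : rat).

HB.instance Definition _ x := GRing.isLinear.Build rat L L *:%R (lie x) (lie_linearr x).

Definition lieDr x y z : ⟦x, y + z⟧ = ⟦x, y⟧ + ⟦x, z⟧ := linearD (lie x) y z.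
Definition lieNr x y : ⟦x, - y⟧ = - ⟦x, y⟧ := linearN (lie x) y.
Definition lieZr x k y : ⟦x, k *: y⟧ = k *: ⟦x, y⟧ := linearZ_LR (lie x) k y.
Definition lie0r x : ⟦x, 0⟧ = 0 := linear0 (lie x).

Lemma lieC x y : ⟦x, y⟧ = - ⟦y, x⟧.
Proof.
apply/eqP; rewrite -addr_eq0 addrC; apply/eqP.
have := liexx (x + y); have E z := lie_linearl z 1 x y.
move: E => /(_ (x + y)); rewrite !scale1r => ->.
by rewrite !lieDr !liexx add0r addr0 => <-; rewrite addrC.
Qed.

Lemma lieDl x y z : ⟦x + y, z⟧ = ⟦x, z⟧ + ⟦y, z⟧.
Proof. by rewrite ![⟦_, z⟧]lieC lieDr opprD. Qed.
Lemma lieNl x y : ⟦- x, y⟧ = - ⟦x, y⟧.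
Proof. by rewrite ![⟦_, y⟧]lieC lieNr. Qed.
Lemma lieZl k x y : ⟦k *: x, y⟧ = k *: ⟦x, y⟧.
Proof. by rewrite ![⟦_, y⟧]lieC lieZr scalerN. Qed.
Lemma lie0l x : ⟦0, x⟧ = 0.
Proof. by rewrite lieC lie0r oppr0. Qed.

Lemma lie_derivation x y z : ⟦x, ⟦y, z⟧⟧ = ⟦⟦x, y⟧, z⟧ + ⟦y, ⟦x, z⟧⟧.
Proof.
have := lie_jacobi x y z; rewrite [⟦y, ⟦z, x⟧⟧]lieC [⟦z, x⟧]lieC lieNl opprK.
rewrite [⟦z, _⟧]lieC => /eqP; rewrite subr_eq0 => /eqP <-.
by rewrite [⟦y, ⟦x, z⟧⟧]lieC addrK.
Qed.

Lemma lie_nested x y z : ⟦⟦x, y⟧, z⟧ = ⟦x, ⟦y, z⟧⟧ - ⟦y, ⟦x, z⟧⟧.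
Proof. by rewrite (lie_derivation x y z) addrK. Qed.

Lemma iter_lie_linear x m k a b :
  iter m (lie x) (k *: a + b) = k *: iter m (lie x) a + iter m (lie x) b.
Proof. by elim: m => //= m ->; rewrite linearP. Qed.

HB.instance Definition _ x m :=
  GRing.isLinear.Build rat L L *:%R (iter m (lie x)) (iter_lie_linear x m).

Lemma iter_lieZ x m k a : iter m (lie x) (k *: a) = k *: iter m (lie x) a.
Proof. exact: linearZ_LR. Qed.

Lemma iter_lie0 x m : iter m (lie x) 0 = 0.
Proof. exact: linear0. Qed.

Lemma iter_lieN x m a : iter m (lie (- x)) a = (-1) ^+ m *: iter m (lie x) a.
Proof.
elim: m => [|m IH] /=; first by rewrite scale1r.
by rewrite IH lieNl lieZr exprS mulN1r scaleNr.
Qed.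

Lemma iter_lie_ge0 x m n a : (m <= n)%N ->
  iter m (lie x) a = 0 -> iter n (lie x) a = 0.
Proof. by move=> /subnK <- z0; rewrite iterD z0 linear0. Qed.

Lemma exp_ad_sum x z N : iter N (lie x) z = 0 ->
  exp_ad x z = \sum_(m < N) (m`!%:R)^-1 *: iter m (lie x) z.
Proof.
move=> z0; rewrite /exp_ad -(big_mkord predT (fun m => (m`!%:R)^-1 *: iter m (lie x) z)).
rewrite -(fsbig_widen [set` index_iota 0 N]) //; first by rewrite -fsbig_seq // iota_uniq.
move=> m [_ /= /negP]; rewrite mem_index_iota /= -leqNgt => Nm.
by rewrite (iter_lie_ge0 Nm z0) scaler0.
Qed.

(** The sum then has infinite support and takes its default value. This keeps [integral_exp_ad] free
    of any nilpotency assumption. *)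
Lemma exp_ad_junk x z : (forall N, iter N (lie x) z != 0) -> exp_ad x z = 0.
Proof.
move=> nz; rewrite /exp_ad fsbig_dflt // setTI.
have -> : (fun m : nat => (m`!%:R)^-1 *: iter m (lie x) z) @^-1` [set~ 0] = setT.
  apply/seteqP; split=> // m _ /= /eqP.
  by rewrite scaler_eq0 invr_eq0 pnatr_eq0 eqn0Ngt fact_gt0 /= (negPf (nz m)).
exact: infinite_nat.
Qed.

(** Cauchy product of the two truncated series; on every antidiagonal but the first the coefficients
    cancel by [sum_alternating_binomial]. *)
Lemma exp_adK x z N : iter N (lie x) z = 0 -> exp_ad (- x) (exp_ad x z) = z.
Proof.
move=> z0; rewrite (exp_ad_sum z0) (@exp_ad_sum _ _ N); last first.
  rewrite iter_lieN linear_sum big1 ?scaler0 // => m _.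
  by rewrite linearZ_LR /= -iterD addnC iterD z0 linear0 scaler0.
pose F (a b : nat) := (((-1) ^+ a / a`!%:R) * (b`!%:R)^-1) *: iter (a + b) (lie x) z.
transitivity (\sum_(a < N) \sum_(b < N) F a b).
  apply: eq_bigr => a _; rewrite iter_lieN scalerA linear_sum scaler_sumr.
  apply: eq_bigr => b _; rewrite linearZ_LR /= scalerA /F iterD.
  by rewrite [_^-1 * (-1) ^+ _]mulrC.
rewrite sum_antidiag => [|a b Nab]; last by rewrite /F (iter_lie_ge0 Nab z0) scaler0.
(* For N = 0 the hypothesis reads z = 0, which agrees with the empty sum. *)
case: N z0 => [|N] z0; first by rewrite big_ord0 -z0.
have E m : \sum_(a < m.+1) F a (m - a)%N = (m == 0%N)%:R *: iter m (lie x) z.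
  rewrite -sum_alternating_binomial scaler_suml; apply: eq_bigr => a _.
  by rewrite /F subnKC // -ltnS.
rewrite (eq_bigr _ (fun (m : 'I_N.+1) _ => E m)) big_ord_recl big1 => [|m _].
  by rewrite addr0 scale1r.
by rewrite scale0r.
Qed.

(** * Reflection of a lowest weight vector z of weight -p under sl2 *)

Section Reflection.
Variables (E F z : L) (p : nat).
Hypothesis sl2E : ⟦⟦E, F⟧, E⟧ = 2 *: E.
Hypothesis zF : ⟦F, z⟧ = 0.
Hypothesis zH : ⟦⟦E, F⟧, z⟧ = - p%:R *: z.
Hypothesis zE : iter p.+1 (lie E) z = 0.

Lemma sl2_weight (k : nat) : ⟦⟦E, F⟧, iter k (lie E) z⟧ = (2 * k%:R - p%:R) *: iter k (lie E) z.
Proof.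
elim: k => [|k IH] /=; first by rewrite zH mulr0 sub0r.
rewrite lie_derivation sl2E IH lieZl lieZr -scalerDl; congr (_ *: _).
by rewrite -natr1; ring.
Qed.

Lemma sl2_lower (k : nat) :
  ⟦F, iter k.+1 (lie E) z⟧ = (k.+1%:R * (p%:R - k%:R)) *: iter k (lie E) z.
Proof.
elim: k => [|k IH] /=.
  by rewrite lie_derivation zF lie0r addr0 [⟦F, E⟧]lieC lieNl zH scaleNr opprK subr0 mul1r.
rewrite lie_derivation [⟦F, E⟧]lieC lieNl -/(iter k.+1 (lie E) z) IH sl2_weight.
rewrite lieZr -scaleNr -scalerDl; congr (_ *: _).
by rewrite -!natr1; ring.
Qed.

(** Read from its top vector, the string of divided powers of E on z is again a string of divided
    powers, now of F. *)
Lemma sl2_lower_iter m : (m <= p)%N ->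
  iter m (lie F) ((p`!%:R)^-1 *: iter p (lie E) z) =
  (m`!%:R / (p - m)`!%:R) *: iter (p - m) (lie E) z.
Proof.
elim: m => [|m IH] mp; first by rewrite subn0 mul1r.
rewrite /= IH 1?ltnW // lieZr -(subnSK mp) sl2_lower scalerA.
congr (_ *: _).
have fN (k : nat) : k`!%:R != 0 :> rat by rewrite pnatr_eq0 -lt0n fact_gt0.
rewrite !factS !natrM.
have -> : p%:R - (p - m.+1)%:R = m.+1%:R :> rat by rewrite natrB // opprB addrC subrK.
have n0 : (p - m.+1).+1%:R != 0 :> rat by rewrite pnatr_eq0.
move: (fN (p - m.+1)%N) n0; move: ((p - m.+1).+1%:R : rat) (m.+1%:R : rat).
by move: (m`!%:R : rat) ((p - m.+1)`!%:R : rat) => u v c e v0 c0; field; rewrite v0 c0.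
Qed.

(* The Weyl element is exp(E) exp(-F) exp(E); its last factor fixes the highest
   weight vector obtained here. *)
Lemma exp_ad_reflection :
  exp_ad (- F) (exp_ad E z) = (p`!%:R)^-1 *: iter p (lie E) z.
Proof.
set v := _ *: _.
have v0 : iter p.+1 (lie F) v = 0.
  rewrite iterS sl2_lower_iter // subnn lieZr zF scaler0 //.
(* Both exponentials sum the same string of vectors, read from opposite ends. *)
suff -> : exp_ad E z = exp_ad F v by rewrite (exp_adK v0).
rewrite (exp_ad_sum v0) (exp_ad_sum zE) [RHS](reindex_inj rev_ord_inj) /=.
apply: eq_bigr => m _; have mp : (m <= p)%N by rewrite -ltnS.
rewrite subSS sl2_lower_iter ?leq_subr // subKn // scalerA mulrA mulVf ?mul1r //.
by rewrite pnatr_eq0 -lt0n fact_gt0.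
Qed.

End Reflection.
End LieTheory.

(** * Divided powers and integral elements *)

(** For a + b = m + 1 the term [G a b] occurs a times in the first family and b times in the second.
    This is the induction step of the Leibniz-type formulas for divided powers. *)
Lemma antidiag_succ (V : lmodType rat) (G : nat -> nat -> V) m :
  \sum_(a < m.+1) (a.+1%:R *: G a.+1 (m - a)%N + (m - a).+1%:R *: G a (m - a).+1) =
  m.+1%:R *: \sum_(a < m.+2) G a (m.+1 - a)%N.
Proof.
rewrite big_split /= scaler_sumr.
have -> : \sum_(a < m.+1) a.+1%:R *: G a.+1 (m - a)%N =
          \sum_(a < m.+2) a%:R *: G a (m.+1 - a)%N.
  by rewrite [RHS]big_ord_recl scale0r add0r; apply: eq_bigr => a _; rewrite subSS.
have -> : \sum_(a < m.+1) (m - a).+1%:R *: G a (m - a).+1 =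
          \sum_(a < m.+2) (m.+1 - a)%:R *: G a (m.+1 - a)%N.
  rewrite [RHS]big_ord_recr /= subnn scale0r addr0; apply: eq_bigr => a _.
  by rewrite subSn // -ltnS.
rewrite -big_split; apply: eq_bigr => a _ /=.
by rewrite -scalerDl -natrD subnKC // -ltnS.
Qed.

Lemma natS_neq0 m : m.+1%:R != 0 :> rat.
Proof. by rewrite pnatr_eq0. Qed.

Lemma fact_inv m : ((m.+1)`!%:R)^-1 = (m.+1%:R)^-1 * (m`!%:R)^-1 :> rat.
Proof. by rewrite factS natrM invfM. Qed.

(** * Divided powers of the inner derivation ad X *)

Section DividedDerivation.
Variables (U : algType rat) (X : U).

Definition comm_with (u : U) : U := X * u - u * X.
Definition divder (m : nat) (u : U) : U := (m`!%:R)^-1 *: iter m comm_with u.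
Arguments divder : simpl never.

Lemma comm_with_is_linear : linear comm_with.
Proof.
move=> k u v; rewrite /comm_with mulrDr mulrDl -scalerAr -scalerAl opprD scalerBr.
by rewrite addrACA.
Qed.
HB.instance Definition _ := GRing.isLinear.Build rat U U *:%R comm_with comm_with_is_linear.

Lemma comm_withM u v : comm_with (u * v) = comm_with u * v + u * comm_with v.
Proof. by rewrite /comm_with mulrBl mulrBr !mulrA addrA subrK. Qed.

Lemma divder0 u : divder 0 u = u.
Proof. by rewrite /divder fact0 invr1 scale1r. Qed.

Lemma divderS m u : m.+1%:R *: divder m.+1 u = comm_with (divder m u).
Proof.
by rewrite /divder fact_inv scalerA mulrA mulfV ?natS_neq0 // mul1r /= linearZ_LR.
Qed.

(** Identities on [divder m.+1] are proved after multiplication by m + 1, so factorials never have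
    to be expanded. *)
Lemma divder_succ m u v : comm_with (divder m u) = m.+1%:R *: v -> divder m.+1 u = v.
Proof. by rewrite -divderS => /scalerI -> //; rewrite natS_neq0. Qed.

Lemma divder_is_linear m : linear (divder m).
Proof.
elim: m => [|m IH] k u v; first by rewrite !divder0.
by apply: divder_succ; rewrite IH linearP /= -!divderS !(scalerDr, scalerA) [k * _]mulrC.
Qed.
HB.instance Definition _ m :=
  GRing.isLinear.Build rat U U *:%R (divder m) (@divder_is_linear m).

Lemma divderM m u v :
  divder m (u * v) = \sum_(a < m.+1) divder a u * divder (m - a) v.
Proof.
elim: m => [|m IH]; first by rewrite big_ord_recl big_ord0 !divder0 addr0.
apply: divder_succ; rewrite IH linear_sum /= -(antidiag_succ (fun a b => divder a u * divder b v)).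
by apply: eq_bigr => a _; rewrite comm_withM -!divderS scalerAl [X in _ = _ + X]scalerAr.
Qed.

Lemma divder1 m : (0 < m)%N -> divder m 1 = 0.
Proof.
case: m => // m _; apply: divder_succ; rewrite scaler0.
elim: m => [|m IH]; first by rewrite divder0 /comm_with mulr1 mul1r subrr.
by rewrite (divder_succ (v := 0)) ?linear0 // scaler0.
Qed.

Lemma divpow_succ m (y : U) : m.+1%:R *: divpow y m.+1 = y * divpow y m.
Proof.
by rewrite /divpow fact_inv scalerA mulrA mulfV ?natS_neq0 // mul1r exprS scalerAr.
Qed.

Lemma divpow_succr m (y : U) : m.+1%:R *: divpow y m.+1 = divpow y m * y.
Proof.
by rewrite /divpow fact_inv scalerA mulrA mulfV ?natS_neq0 // mul1r exprSr scalerAl.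
Qed.

(** Degree m part of exp(ad X)(u) = exp(X) u exp(-X). The right-hand side involves X through divided
    powers only, with integral coefficients. *)
Lemma divder_divpow m u :
  divder m u = \sum_(a < m.+1) divpow X a * u * divpow (- X) (m - a).
Proof.
elim: m => [|m IH].
  by rewrite big_ord_recl big_ord0 divder0 /divpow fact0 invr1 !scale1r !expr0 mul1r mulr1 addr0.
apply: divder_succ; rewrite IH linear_sum /=.
rewrite -(antidiag_succ (fun a b => divpow X a * u * divpow (- X) b)).
apply: eq_bigr => a _; rewrite 2!scalerAl divpow_succ [X in _ = _ + X]scalerAr divpow_succr.
by rewrite /comm_with !mulrA mulrN.
Qed.

(** The polynomial p is exp(t ad X)(u), where t is the indeterminate. *)
Definition exp_coefs (p : {poly U}) (u : U) := forall m, p`_m = divder m u.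

Lemma exp_coefsM p q u v :
  exp_coefs p u -> exp_coefs q v -> exp_coefs (p * q) (u * v).
Proof.
move=> pu qv m; rewrite coefM divderM; apply: eq_bigr => a _.
by rewrite pu qv.
Qed.

Lemma exp_coefsX p u k : exp_coefs p u -> exp_coefs (p ^+ k) (u ^+ k).
Proof.
move=> pu; elim: k => [|k IH]; last by rewrite !exprS; apply: exp_coefsM.
by move=> m; rewrite !expr0 coef1; case: m => [|m]; rewrite ?divder0 ?divder1.
Qed.

(** The map exp(t ad X) is multiplicative, hence takes u^k to the k-th power of p = exp(t ad X)(u);
    evaluating at t = 1 gives the claim. *)
Lemma divpow_exp N u k : iter N comm_with u = 0 ->
  exists M, divpow (\sum_(m < N) divder m u) k = \sum_(m < M) divder m (divpow u k).
Proof.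
move=> u0; pose p := \poly_(m < N) divder m u.
have pu : exp_coefs p u.
  move=> m; rewrite coef_poly; case: ltnP => // Nm.
  rewrite /divder -(subnK Nm) iterD u0; suff -> : iter (m - N) comm_with 0 = 0 by rewrite scaler0.
  by elim: (m - N)%N => //= j ->; rewrite linear0.
have -> : \sum_(m < N) divder m u = p.[1].
  rewrite horner_poly; apply: eq_bigr => m _; rewrite expr1n mulr1 //.
exists (size (p ^+ k)); rewrite /divpow -horner_exp_comm; last by rewrite /comm_poly mulr1 mul1r.
rewrite horner_coef scaler_sumr; apply: eq_bigr => m _.
by rewrite expr1n mulr1 (exp_coefsX k pu) [RHS](linearZ_LR (divder m)).
Qed.

End DividedDerivation.

(** * Integral elements and their stability under exponentials *)

Section Integral.
Variables (L : lieAlgType rat) (U : algType rat) (iota : L -> U).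
Hypothesis iota_hom : lie_to_alg_hom iota.
Variable B : set U.
Hypothesis B_ring : subring_closed [in B].

Definition integral (z : L) := forall m, B (divpow (iota z) m).

Lemma mem_subring1 : B 1.
Proof. by case: B_ring => + _ _; rewrite in_setE. Qed.
Lemma mem_subringB u v : B u -> B v -> B (u - v).
Proof.
case: B_ring => _ BB _ Bu Bv; have := BB u v; rewrite !in_setE; exact.
Qed.
Lemma mem_subringM u v : B u -> B v -> B (u * v).
Proof.
case: B_ring => _ _ BM Bu Bv; have := BM u v; rewrite !in_setE; exact.
Qed.
Lemma mem_subring0 : B 0.
Proof. by rewrite -(subrr 1); apply: mem_subringB mem_subring1 mem_subring1. Qed.
Lemma mem_subringN u : B u -> B (- u).
Proof. by rewrite -sub0r; apply: mem_subringB mem_subring0. Qed.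
Lemma mem_subringD u v : B u -> B v -> B (u + v).
Proof. by move=> Bu Bv; rewrite -(opprK v); apply/mem_subringB/mem_subringN. Qed.
Lemma mem_subring_sum n (F : 'I_n -> U) : (forall i, B (F i)) -> B (\sum_i F i).
Proof.
by move=> BF; elim/big_ind: _ => //; [exact: mem_subring0 | exact: mem_subringD].
Qed.

HB.instance Definition _ := GRing.isLinear.Build rat L U *:%R iota (proj1 iota_hom).

Lemma divpowN (u : U) m : divpow (- u) m = (-1) ^+ m * divpow u m.
Proof. by rewrite /divpow [in LHS]exprNn scalerAr. Qed.

Lemma mem_divpowN u m : B (divpow u m) -> B (divpow (- u) m).
Proof.
rewrite divpowN; case: (boolP (odd m)) => om; rewrite -signr_odd ?om ?(negPf om).
  by rewrite mulN1r; apply: mem_subringN.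
by rewrite mul1r.
Qed.

Lemma divpow_integral0 : integral 0.
Proof.
move=> m; rewrite /divpow linear0; case: m => [|m].
  by rewrite fact0 invr1 scale1r; apply: mem_subring1.
by rewrite expr0n scaler0; apply: mem_subring0.
Qed.

Lemma divpow_integralN z : integral z -> integral (- z).
Proof. by move=> zB m; rewrite linearN; apply: mem_divpowN. Qed.

Lemma integral_sign (s : bool) z : integral ((-1) ^+ s *: z) -> integral z.
Proof.
by case: s; rewrite ?scale1r // scaleN1r => /divpow_integralN; rewrite opprK.
Qed.

Lemma iota_iter_lie m x z :
  iota (iter m (lie x) z) = iter m (comm_with (iota x)) (iota z).
Proof. by elim: m => //= m <-; rewrite (proj2 iota_hom). Qed.

Lemma integral_exp_ad x z : integral x -> integral z -> integral (exp_ad x z).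
Proof.
move=> xB zB k.
(* Without nilpotency [exp_ad x z] is 0, whose divided powers are 1 and 0. *)
have [[N zN]|nz] := pselect (exists N, iter N (lie x) z = 0); last first.
  rewrite exp_ad_junk; last by move=> N; apply/eqP => zN; apply: nz; exists N.
  exact: divpow_integral0.
have uN : iter N (comm_with (iota x)) (iota z) = 0 by rewrite -iota_iter_lie zN linear0.
have -> : iota (exp_ad x z) = \sum_(m < N) divder (iota x) m (iota z).
  rewrite (exp_ad_sum zN) linear_sum; apply: eq_bigr => m _.
  by rewrite linearZ_LR /= iota_iter_lie.
have [M ->] := divpow_exp k uN.
apply: mem_subring_sum => m; rewrite divder_divpow; apply: mem_subring_sum => a.
by apply: mem_subringM; [apply: mem_subringM|apply: mem_divpowN]; [exact: xB|exact: zB|exact: xB].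
Qed.

Lemma integral_exp_ad_inv x z N : iter N (lie x) z = 0 ->
  integral x -> integral (exp_ad x z) -> integral z.
Proof.
by move=> zN xB eB; rewrite -(exp_adK zN); apply: integral_exp_ad eB; apply: divpow_integralN.
Qed.

Lemma integral_reflection (E F z : L) p :
  ⟦⟦E, F⟧, E⟧ = 2 *: E -> ⟦F, z⟧ = 0 -> ⟦⟦E, F⟧, z⟧ = - p%:R *: z ->
  iter p.+1 (lie E) z = 0 -> integral E -> integral F -> integral z ->
  integral ((p`!%:R)^-1 *: iter p (lie E) z).
Proof.
move=> EE Fz Hz Ez EB FB zB; rewrite -(exp_ad_reflection EE Fz Hz Ez).
by apply/integral_exp_ad/integral_exp_ad => //; apply: divpow_integralN.
Qed.

End Integral.

(** * Local nilpotency in a Kac-Moody presentation *)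

Section SubLie.
Variables (L : lieAlgType rat) (P : L -> Prop).
Hypothesis P0 : P 0.
Hypothesis PP : forall k a b, P a -> P b -> P (k *: a + b).
Hypothesis Plie : forall a b, P a -> P b -> P ⟦a, b⟧.

(** The elements satisfying P are made into a Lie algebra of their own, so that the universal
    property of a presentation can be applied to it. *)
Definition sub_pred : {pred L} := [pred x | `[< P x >]].

Lemma sub_predE x : (x \in sub_pred) = `[< P x >].
Proof. by []. Qed.

Lemma sub_submod : submod_closed sub_pred.
Proof.
split=> [|k a b]; first by rewrite sub_predE; apply/asboolP.
by rewrite !sub_predE => /asboolP Pa /asboolP Pb; apply/asboolP/PP.
Qed.
HB.instance Definition _ := GRing.isSubmodClosed.Build rat L sub_pred sub_submod.

Definition sub_lie := {x : L | x \in sub_pred}.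
HB.instance Definition _ := SubChoice.on sub_lie.
HB.instance Definition _ := [SubChoice_isSubLmodule of sub_lie by <:].

Lemma sub_valP (a : sub_lie) : P (val a).
Proof. by apply/asboolP; exact: (valP a). Qed.

Definition to_sub x (Px : P x) : sub_lie := Sub x (introT (asboolP (P x)) Px).

Definition sub_bracket (a b : sub_lie) : sub_lie := to_sub (Plie (sub_valP a) (sub_valP b)).

Lemma val_sub_bracket a b : val (sub_bracket a b) = ⟦val a, val b⟧.
Proof. by rewrite /sub_bracket SubK. Qed.

Lemma sub_bracketl (b : sub_lie) : linear (sub_bracket^~ b).
Proof.
move=> k x y; apply: val_inj; rewrite linearP !val_sub_bracket linearP.
by rewrite lieDl lieZl.
Qed.
Lemma sub_bracketr (a : sub_lie) : linear (sub_bracket a).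
Proof.
by move=> k x y; apply: val_inj; rewrite linearP !val_sub_bracket !linearP.
Qed.
Lemma sub_bracketxx (a : sub_lie) : sub_bracket a a = 0.
Proof. by apply: val_inj; rewrite val_sub_bracket liexx linear0. Qed.
Lemma sub_jacobi (x y z : sub_lie) :
  sub_bracket x (sub_bracket y z) + sub_bracket y (sub_bracket z x) +
  sub_bracket z (sub_bracket x y) = 0.
Proof. apply: val_inj; exact: (lie_jacobi (val x) (val y) (val z)). Qed.
HB.instance Definition _ := Lmodule_isLieAlgebra.Build rat sub_lie
  sub_bracketl sub_bracketr sub_bracketxx sub_jacobi.

Lemma val_lie (a b : sub_lie) : val ⟦a, b⟧ = ⟦val a, val b⟧.
Proof. exact: val_sub_bracket. Qed.

Lemma val_iter_lie m (a b : sub_lie) :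
  val (iter m (lie a) b) = iter m (lie (val a)) (val b).
Proof. by elim: m => // m IH; rewrite !iterS val_lie IH. Qed.

Lemma val_scale k (a : sub_lie) : val (k *: a) = k *: val a.
Proof. exact: linearZ_LR. Qed.

(** The presentation maps L to the subalgebra cut out by P, fixing the generators. Followed by the
    inclusion, this map agrees with the identity on generators, hence everywhere. *)
Lemma km_ind X (g : km_gen (rank X) -> L) :
  presents (@km_relations X) g -> (forall a, P (g a)) -> forall x, P x.
Proof.
move=> [rel univ] Pg x; pose g' a := to_sub (Pg a).
have vg a : val (g' a) = g a by rewrite SubK.
have rel' : km_relations g'.
  case: rel => R1 R2 R3 R4 R5; split.
  - by move=> i j; apply: val_inj; rewrite val_lie !vg R1.
  - by move=> i j; apply: val_inj; rewrite val_lie !vg R2; case: eqP; rewrite ?vg.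
  - by move=> i j; apply: val_inj; rewrite val_lie val_scale !vg R3.
  - by move=> i j; apply: val_inj; rewrite val_lie val_scale !vg R4.
  - move=> i j /R5[E1 E2]; split; apply: val_inj; rewrite val_iter_lie !vg //.
have [[f [[flin flie] fg]] _] := univ _ _ rel'.
have [_ uniq] := univ _ _ rel.
suff <- : val (f x) = x by apply: sub_valP.
apply: (uniq (fun x => val (f x)) id) => //.
- by split=> [k a b|a b]; rewrite ?flin ?linearP // flie val_lie.
- by move=> a; rewrite fg vg.
Qed.

End SubLie.

Definition ad_nilpotent (L : lieAlgType rat) (x y : L) : Prop :=
  exists N, iter N (lie x) y = 0.

Section LocalNilpotency.
Variables (L : lieAlgType rat) (x : L).

(** Leibniz rule. The induction is on the sum of the two orders, because each application of ad x
    lowers one of them. *)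
Lemma ad_nilpotent_lie a b :
  ad_nilpotent x a -> ad_nilpotent x b -> ad_nilpotent x ⟦a, b⟧.
Proof.
move=> [N aN] [M bM]; exists (N + M)%N.
have [s E] : exists s, (N + M)%N = s by exists (N + M)%N.
rewrite E; move: E.
elim: s N M a b aN bM => [|s IH] [|N] [|M] a b aN bM // E;
  try by [rewrite (aN : a = 0) lie0l linear0 | rewrite (bM : b = 0) lie0r linear0].
rewrite iterSr lie_derivation -[⟦⟦x, a⟧, b⟧]scale1r iter_lie_linear scale1r.
have -> : iter s (lie x) ⟦⟦x, a⟧, b⟧ = 0 by apply: (IH N M.+1) => //; [rewrite -iterSr | lia].
by rewrite add0r; apply: (IH N.+1 M) => //; [rewrite -iterSr | lia].
Qed.

Lemma ad_nilpotent_linear k a b :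
  ad_nilpotent x a -> ad_nilpotent x b -> ad_nilpotent x (k *: a + b).
Proof.
move=> [N aN] [M bM]; exists (N + M)%N; rewrite iter_lie_linear.
by rewrite (iter_lie_ge0 _ aN) ?leq_addr // (iter_lie_ge0 _ bM) ?leq_addl // scaler0 addr0.
Qed.

End LocalNilpotency.

(** The elements on which ad e_i is nilpotent form a Lie subalgebra, so generators suffice: the
    Serre relations settle e_j, and f_i goes to h_i, then to a multiple of e_i, then to 0. The case
    of f_i is symmetric. *)
Lemma km_ad_nilpotent X (L : lieAlgType rat) (g : km_gen (rank X) -> L) :
  presents (@km_relations X) g -> forall i x,
  ad_nilpotent (g (KMe i)) x /\ ad_nilpotent (g (KMf i)) x.
Proof.
move=> pres i x; have [[R1 R2 R3 R4 R5] _] := pres; split; move: x.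
  apply: (@km_ind L _ _ _ _ X g pres) => [|k a b|a b|[j|j|j]].
  - by exists 0%N.
  - exact: ad_nilpotent_linear.
  - exact: ad_nilpotent_lie.
  - have [<-|ij] := eqVneq i j; first by exists 1%N; rewrite /= liexx.
    by have [E _] := R5 _ _ ij; eexists; exact: E.
  - exists 3%N => /=; rewrite R2; case: eqP => _; rewrite ?lie0r //.
    by rewrite [⟦_, g (KMh i)⟧]lieC R3 lieNr lieZr liexx scaler0 oppr0.
  - by exists 2%N; rewrite /= [⟦_, g (KMh j)⟧]lieC R3 lieNr lieZr liexx scaler0 oppr0.
apply: (@km_ind L _ _ _ _ X g pres) => [|k a b|a b|[j|j|j]].
- by exists 0%N.
- exact: ad_nilpotent_linear.
- exact: ad_nilpotent_lie.
- exists 3%N => /=; rewrite [⟦_, g (KMe j)⟧]lieC R2 lieNr; case: eqP => [->|_]; last by rewrite !(lie0r, oppr0).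
  by rewrite [⟦_, g (KMh i)⟧]lieC R4 !(lieNr, lieZr) liexx !(scaler0, oppr0).
- have [<-|ij] := eqVneq i j; first by exists 1%N; rewrite /= liexx.
  by have [_ E] := R5 _ _ ij; eexists; exact: E.
- by exists 2%N; rewrite /= [⟦_, g (KMh j)⟧]lieC R4 !(lieNr, lieZr) liexx !(scaler0, oppr0).
Qed.

(** * Reflections in the loop realization *)

(** The bracket with h is a derivation, and the terms where it hits one of the factors X all
    coincide because X' commutes with X. *)
Lemma lie_iter_derivation (L : lieAlgType rat) (h X X' z : L) m :
  ⟦h, X⟧ = X' -> ⟦X, X'⟧ = 0 ->
  ⟦h, iter m.+1 (lie X) z⟧ =
  m.+1%:R *: ⟦X', iter m (lie X) z⟧ + iter m.+1 (lie X) ⟦h, z⟧.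
Proof.
move=> hX XX'; elim: m => [|m IH]; first by rewrite /= lie_derivation hX scale1r.
rewrite iterS lie_derivation hX IH lieDr lieZr lie_derivation XX' lie0l add0r.
by rewrite -!iterS addrA -{1}[⟦X', _⟧]scale1r -scalerDl nat1r.
Qed.

Lemma int_step_ind (P : int -> Prop) :
  P 0 -> (forall r, P r -> P (r + 1)) -> (forall r, P r -> P (r - 1)) -> forall r, P r.
Proof.
move=> P0 Pp Pm; elim/int_rect => [//|n IH|n IH].
  by rewrite (_ : n.+1%:Z = n%:Z + 1); [apply: Pp | lia].
by rewrite (_ : - n.+1%:Z = - n%:Z - 1); [apply: Pm | lia].
Qed.

Section LoopReflections.
Variables (X : affine_type) (d : 'I_(rank X).+1 -> nat) (L : lieAlgType rat).
Variable y : drinfeld_gen (rank X) -> L.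
Hypothesis rel : drinfeld_relations d y.

Let x u i r := y (Dx u i r).
Let adm := drinfeld_deg d.
Let a i j r : rat := (loop_cartan d i j r)%:~R.

Lemma adm0 i : adm i 0. Proof. exact: dvdz0. Qed.
Lemma admD i r s : adm i r -> adm i s -> adm i (r + s).
Proof. exact: rpredD. Qed.
Lemma admN i r : adm i r -> adm i (- r).
Proof. by rewrite /adm /drinfeld_deg rpredN. Qed.
Hint Resolve adm0 admD admN : core.

Lemma x_nadm u i r : ~~ adm i r -> x u i r = 0.
Proof. by case: rel => + _; apply. Qed.

Lemma lie_c_x u i r : ⟦y Dc, x u i r⟧ = 0.
Proof. by case: rel => _ [_ [+ _]]; apply. Qed.

Lemma lie_h_x u i j r s : adm i r -> adm j s ->
  ⟦y (Dh i r), x u j s⟧ = ((-1) ^+ u * a i j r) *: x u j (r + s).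
Proof. by case: rel => _ [_ [_ [_ [_ [_ [+ _]]]]]]; apply. Qed.

(** The opposite sign is a variable w with an equation: together with [negb_swap], this lets u and w
    exchange roles without double negations. *)
Lemma lie_x_opp u w i j r s : w = ~~ u -> i != j -> adm i r -> adm j s ->
  ⟦x u i r, x w j s⟧ = 0.
Proof.
case: rel => _ [_ [_ [_ [_ [R _]]]]] -> ij ir js.
by case: u => /=; [rewrite lieC R // eq_sym (negPf ij) oppr0 | rewrite R // (negPf ij)].
Qed.

(* The central terms of the brackets disappear here. *)
Lemma lie_coroot u w v i j r s t : w = ~~ u -> adm i r -> adm i s -> adm j t ->
  ⟦⟦x u i r, x w i s⟧, x v j t⟧ =
  ((-1) ^+ u * (-1) ^+ v * a i j (r + s)) *: x v j (r + s + t).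
Proof.
case: rel => _ [_ [_ [_ [_ [R _]]]]] -> ir is_ jt.
have key r' s' : adm i r' -> adm i s' -> ⟦⟦x false i r', x true i s'⟧, x v j t⟧ =
    ((-1) ^+ v * a i j (r' + s')) *: x v j (r' + s' + t).
  move=> ir' is'; rewrite R // eqxx lieDl lie_h_x ?admD //.
  by case: ifP => _; rewrite ?lieZl ?lie_c_x ?scaler0 ?lie0l addr0.
case: u => /=; last by rewrite key // mul1r.
rewrite [⟦x true _ _, _⟧]lieC lieNl key // [s + r]addrC.
by rewrite -scaleNr mulN1r mulNr.
Qed.

Lemma sg_same (u : bool) : (-1) ^+ u * (-1) ^+ u = 1 :> rat.
Proof. by case: u. Qed.
Lemma sg_opp u w : w = ~~ u -> (-1) ^+ w * (-1) ^+ u = -1 :> rat.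
Proof. by move->; case: u. Qed.
Lemma sg_opp' u w : w = ~~ u -> (-1) ^+ u * (-1) ^+ w = -1 :> rat.
Proof. by move->; case: u. Qed.

Lemma negb_swap (u w : bool) : w = ~~ u -> u = ~~ w.
Proof. by move->; rewrite negbK. Qed.

Lemma lie_x_same u i r s : ~~ special_node d i -> adm i r -> adm i s ->
  ⟦x u i r, x u i s⟧ = 0.
Proof.
by case: rel => _ [_ [_ [_ [_ [_ [_ [R _]]]]]]] nsp ir is_; apply: R => //; rewrite nsp.
Qed.

Lemma serre u i j r s (p : nat) : i != j -> adm i r -> adm j s ->
  cartan X (fnode i) (fnode j) = - p%:Z ->
  iter p.+1 (lie (x u i r)) (x u j s) = 0.
Proof.
case: rel => _ [_ [_ [_ [_ [_ [_ [_ [_ [_ R]]]]]]]]] ij ir js cp.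
have := R u _ _ _ _ ij ir js; rewrite cp opprK.
by rewrite (_ : `|(1 + p%:Z)%R|%N = p.+1) //; lia.
Qed.

Lemma a_self i r : ~~ special_node d i -> a i i r = 2.
Proof. by rewrite /a /loop_cartan => /negPf ->; rewrite mxE !eqxx mulrz_nat. Qed.

Lemma a_neq i j r (p : nat) : i != j ->
  cartan X (fnode i) (fnode j) = - p%:Z -> a i j r = - p%:R.
Proof. by rewrite /a /loop_cartan => /negPf -> ->; rewrite andbF mulrNz. Qed.

(** * Properties closed under negation and sl2 reflections; G will be integrality for the Kac-Moody
    form *)

Variable G : L -> Prop.
Hypothesis G_opp : forall z, G z -> G (- z).
Hypothesis G_reflection : forall (E F z : L) p,
  ⟦⟦E, F⟧, E⟧ = 2 *: E -> ⟦F, z⟧ = 0 -> ⟦⟦E, F⟧, z⟧ = - p%:R *: z ->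
  iter p.+1 (lie E) z = 0 -> G E -> G F -> G z -> G ((p`!%:R)^-1 *: iter p (lie E) z).

Lemma G_scale_opp z : G (- 1 *: z) -> G z.
Proof. by rewrite scaleN1r => /G_opp; rewrite opprK. Qed.

(** The reflection in alpha + s delta sends -alpha + r delta to alpha + (r + 2s) delta, here with p
    = 2; when w is the negative sign, alpha is replaced by its opposite. *)
Lemma reflect_same u w i r s : w = ~~ u -> ~~ special_node d i ->
  adm i r -> adm i s ->
  G (x u i r) -> G (x w i s) -> G (x u i (- s)) -> G (x w i (r + s + s)).
Proof.
move=> uw nsp ir is_ Gr Gs GNs; apply: G_scale_opp.
have wu := negb_swap uw.
have E2 : ⟦x w i s, ⟦x w i s, x u i r⟧⟧ = - 2 *: x w i (r + s + s).
  rewrite [LHS]lieC lie_coroot // sg_same a_self // mul1r scaleNr.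
  by rewrite [s + r]addrC.
suff -> : -1 *: x w i (r + s + s) = (2`!%:R)^-1 *: iter 2 (lie (x w i s)) (x u i r).
  apply: (G_reflection (F := x u i (- s))) => //.
  - by rewrite lie_coroot ?admN // sg_same a_self // mul1r subrr add0r.
  - by rewrite lie_x_same ?admN.
  - by rewrite lie_coroot ?admN // sg_opp // a_self // subrr add0r mulN1r.
  - by rewrite iterS /= E2 lieZr lie_x_same ?scaler0 // !admD.
by rewrite /= E2 scalerA.
Qed.

Lemma rank1_nonspecial i : ~~ special_node d i -> dtilde d i = 1%N ->
  (forall u, G (x u i 0)) -> G (x true i 1) -> G (x false i (-1)) ->
  forall u r, G (x u i r).
Proof.
move=> nsp d1 G0 G1 Gm1.
have admT r : adm i r by rewrite /adm /drinfeld_deg d1 dvd1z.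
(* Taking s = 0 changes the sign of the root and keeps the degree. *)
have flip u r : G (x u i r) -> G (x (~~ u) i r).
  move=> Gr; have := @reflect_same u (~~ u) i r 0 erefl nsp (admT _) (admT _) Gr.
  by rewrite oppr0 !addr0; apply.
have both r : (exists u, G (x u i r)) -> forall u, G (x u i r).
  by case=> v Gv u; have [->//|uv] := eqVneq u v; have := flip _ _ Gv; case: u v uv {Gv} => [] [].
have GG1 : forall u, G (x u i 1) by apply: both; exists true.
have GGm1 : forall u, G (x u i (-1)) by apply: both; exists false.
have up r : (forall u, G (x u i r)) -> forall u, G (x u i (r + 2)).
  move=> Gr; apply: both; exists true.
  by have := @reflect_same false true i r 1 erefl nsp (admT _) (admT _) (Gr _) (GG1 _) (GGm1 _); rewrite -addrA.
have down r : (forall u, G (x u i r)) -> forall u, G (x u i (r - 2)).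
  move=> Gr; apply: both; exists true.
  by have := @reflect_same false true i r (-1) erefl nsp (admT _) (admT _) (Gr _) (GGm1 _) (GG1 _); rewrite -addrA.
(* The available shifts change the degree by 2, so two consecutive degrees are carried along. *)
suff GG r : (forall u, G (x u i r)) /\ (forall u, G (x u i (r + 1))) by move=> u r; apply: (GG r).1.
elim/int_step_ind: r => [|r [H1 H2]|r [H1 H2]] //.
  by split=> //; rewrite -addrA; apply: up.
by split; rewrite ?subrK // (_ : r - 1 = r + 1 - 2); [apply: down|lia].
Qed.

(** * Translations from a non-special node j to a neighbour i *)

Section Step.
Variables (i j : 'I_(rank X)) (p : nat) (u w : bool) (r s : int).
Hypotheses (uw : w = ~~ u) (ij : i != j) (nsp : ~~ special_node d j).
Hypothesis cp : cartan X (fnode j) (fnode i) = - p.+1%:Z.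
Hypotheses (jr : adm j r) (is_ : adm i s).

Let ji : j != i. Proof. by rewrite eq_sym. Qed.
Let wu : u = ~~ w := negb_swap uw.

Lemma lowering_x m : adm j m -> ⟦⟦x w j 0, x u j m⟧, x u i s⟧ = p.+1%:R *: x u i (m + s).
Proof.
by move=> jm; rewrite lie_coroot // sg_opp // (a_neq _ ji cp) mulrNN mul1r add0r.
Qed.

Lemma lowering_step m n : adm j m -> adm j n ->
  ⟦⟦x w j 0, x u j m⟧, x u j n⟧ = - 2 *: x u j (m + n).
Proof. by move=> jm jn; rewrite lie_coroot // sg_opp // a_self // mulN1r add0r. Qed.

(** Apply h, which is h_{j,-r} up to sign and a central term, to the Serre relation of exponent p +
    2. It turns one factor of degree r into degree 0; the term where h hits [x u i s] vanishes by
    the Serre relation again, or because its degree is not admissible. *)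
Lemma polarized_serre : ⟦x u j 0, iter p.+1 (lie (x u j r)) (x u i s)⟧ = 0.
Proof.
pose h := ⟦x u j 0, x w j (- r)⟧.
have hX : ⟦h, x u j r⟧ = 2 *: x u j 0.
  by rewrite lie_coroot ?admN // sg_same a_self // mul1r add0r addNr.
have XX : ⟦x u j r, 2 *: x u j 0⟧ = 0 by rewrite lieZr lie_x_same ?scaler0.
have := lie_iter_derivation (x u i s) p.+1 hX XX.
rewrite (serre _ ji jr is_ cp) lie0r lie_coroot ?admN // iter_lieZ.
have -> : iter p.+2 (lie (x u j r)) (x u i (0 - r + s)) = 0.
  have [is'|/x_nadm ->] := boolP (adm i (0 - r + s)); first exact: serre cp.
  by rewrite iter_lie0.
rewrite scaler0 addr0 lieZl scalerA => /esym/eqP; rewrite scaler_eq0.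
by rewrite mulf_eq0 !pnatr_eq0 /= => /eqP.
Qed.

(** Two reflections in succession: the one in alpha_j + r delta raises [x u i s] to the vector v,
    and the one in alpha_j brings v back to the root of node i. The hypothesis identifies the result
    as a multiple of [x u i t]; the square of the factorial is absorbed by the two divided
    powers. *)
Lemma reflect_other (e : bool) t :
  (forall v m, adm j m -> G (x v j m)) -> G (x u i s) ->
  iter p.+1 (lie (x w j 0)) (iter p.+1 (lie (x u j r)) (x u i s)) =
    ((-1) ^+ e * (p.+1)`!%:R ^+ 2) *: x u i t ->
  G (x u i t).
Proof.
move=> Gj Gi lowered.
pose v := ((p.+1)`!%:R)^-1 *: iter p.+1 (lie (x u j r)) (x u i s).
have Gv : G v.
  apply: (G_reflection (F := x w j (- r))) => //.
  - by rewrite lie_coroot ?admN // sg_same a_self // mul1r subrr add0r.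
  - by rewrite lie_x_opp // admN.
  - by rewrite lie_coroot ?admN // sg_same (a_neq _ ji cp) mul1r subrr add0r.
  - exact: serre cp.
  - exact: Gj.
  - by apply: Gj; rewrite admN.
have lv : iter p.+1 (lie (x w j 0)) v = ((-1) ^+ e * (p.+1)`!%:R) *: x u i t.
  rewrite iter_lieZ lowered scalerA; congr (_ *: _).
  have : (p.+1)`!%:R != 0 :> rat by rewrite pnatr_eq0 -lt0n fact_gt0.
  by move: ((p.+1)`!%:R : rat) ((-1) ^+ e : rat) => f c f0; field.
have : G (((p.+1)`!%:R)^-1 *: iter p.+1 (lie (x w j 0)) v).
  apply: (G_reflection (F := x u j 0)) => //; try exact: Gj.
  - by rewrite lie_coroot // sg_same a_self // mul1r !addr0.
  - by rewrite lieZr polarized_serre scaler0.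
  (* The vector [x u i s] has weight p + 1 and each of the p + 1 raising factors contributes -2, so
     the weight of v is -(p + 1). *)
  - rewrite lieZr (lie_iter_derivation _ _ (lowering_step (adm0 _) jr)); last first.
      by rewrite lieZr lie_x_same ?scaler0 // add0r.
    rewrite lowering_x // !add0r lieZl iter_lieZ !scalerA -scalerDl.
    by rewrite scalerA; congr (_ *: _); ring.
  - rewrite iterS lv lieZr; have [it|/x_nadm ->] := boolP (adm i t).
      by rewrite lie_x_opp ?scaler0.
    by rewrite lie0r scaler0.
rewrite lv scalerA mulrCA mulVf ?mulr1; last by rewrite pnatr_eq0 -lt0n fact_gt0.
by case: e {lowered lv} => /=; [apply: G_scale_opp | rewrite scale1r].
Qed.

End Step.

Let all_in i := forall v m, adm i m -> G (x v i m).

(** When a_{ji} = -1, a translation by m takes degree 0 to degree m in one move. *)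
Lemma spread1 i j : i != j -> ~~ special_node d j ->
  cartan X (fnode j) (fnode i) = - 1%:Z -> dtilde d i = dtilde d j ->
  all_in j -> (forall u, G (x u i 0)) -> all_in i.
Proof.
move=> ij nsp cp dd Gj Gi u m im; have jm : adm j m by rewrite /adm /drinfeld_deg -dd.
apply: (@reflect_other i j 0 u (~~ u) m 0 _ _ _ _ _ _ false m) => //.
have V : ⟦x (~~ u) j 0, x u i 0⟧ = 0 by rewrite lie_x_opp ?negbK // eq_sym.
rewrite /= lie_derivation V lie0r addr0.
by rewrite (lowering_x erefl ij cp) // addr0 mul1r expr1n.
Qed.

(** * Crossing a double or triple edge towards the longer root *)

Section Crossing.
Variables (i j : 'I_(rank X)) (p : nat) (u w : bool) (r s : int).
Hypotheses (uw : w = ~~ u) (ij : i != j) (nsp : ~~ special_node d j).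
Hypothesis cp : cartan X (fnode j) (fnode i) = - p.+1%:Z.
Hypotheses (jr : adm j r) (is_ : adm i s) (irs : ~~ adm i (r + s)).

Lemma lowering1 m : adm j m ->
  ⟦x w j 0, ⟦x u j m, x u i s⟧⟧ = p.+1%:R *: x u i (m + s).
Proof.
have V : ⟦x w j 0, x u i s⟧ = 0 by rewrite lie_x_opp ?(negb_swap uw) // eq_sym.
by move=> jm; rewrite lie_derivation V lie0r addr0 (lowering_x uw ij cp).
Qed.

Lemma lowering_coroot m n : adm j m -> adm j n ->
  ⟦⟦x w j 0, x u j m⟧, ⟦x u j n, x u i s⟧⟧ =
  - 2 *: ⟦x u j (m + n), x u i s⟧ + p.+1%:R *: ⟦x u j n, x u i (m + s)⟧.
Proof.
move=> jm jn; rewrite lie_derivation (lowering_step uw nsp) // lieZl.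
by rewrite (lowering_x uw ij cp) // lieZr.
Qed.

(** The cross terms contain [x u i (r + s)], which is 0 since its degree is not admissible. *)
Lemma lowering2 :
  ⟦x w j 0, ⟦x u j r, ⟦x u j r, x u i s⟧⟧⟧ = - 2 *: ⟦x u j (r + r), x u i s⟧.
Proof.
by rewrite lie_derivation lowering_coroot // lowering1 // (x_nadm _ irs) !(scaler0, lie0r, addr0).
Qed.

Lemma spread2 : p = 1%N -> all_in j -> G (x u i s) -> G (x u i (r + r + s)).
Proof.
move=> p1 Gj Gi.
(* The total coefficient is -2 times 2, that is the opposite of the square of 2!, whence the sign
   [true]. *)
apply: (@reflect_other i j p u w r s _ _ _ _ _ _ true) => //.
have jrr : adm j (r + r) by rewrite admD.
have L1 := lowering1 jrr; have L2 := lowering2; move: L1 L2; rewrite p1 => L1 L2.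
by rewrite /= L2 lieZr L1 scalerA; congr (_ *: _).
Qed.

Lemma spread3 : p = 2%N -> ~~ adm i (r + r + s) ->
  all_in j -> G (x u i s) -> G (x u i (r + (r + r) + s)).
Proof.
move=> p2 irrs Gj Gi.
(* The total coefficient is -6 times -2 times 3, the square of 3!. *)
apply: (@reflect_other i j p u w r s _ _ _ _ _ _ false) => //.
have jrr : adm j (r + r) by rewrite admD.
have jrrr : adm j (r + (r + r)) by rewrite admD.
have comm : ⟦x u j (r + r), ⟦x u j r, x u i s⟧⟧ = ⟦x u j r, ⟦x u j (r + r), x u i s⟧⟧.
  by rewrite lie_derivation lie_x_same // lie0l add0r.
have L3 : ⟦x w j 0, ⟦x u j r, ⟦x u j r, ⟦x u j r, x u i s⟧⟧⟧⟧ =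
    - 6 *: ⟦x u j r, ⟦x u j (r + r), x u i s⟧⟧.
  rewrite lie_derivation lowering2 lie_derivation lowering_coroot //.
  rewrite (lowering_step uw nsp) // (x_nadm _ irs) lie0r scaler0 addr0 lieZl comm !lieZr.
  by rewrite -!scalerDl; congr (_ *: _).
have L4 : ⟦x w j 0, ⟦x u j r, ⟦x u j (r + r), x u i s⟧⟧⟧ =
    - 2 *: ⟦x u j (r + (r + r)), x u i s⟧.
  rewrite lie_derivation lowering_coroot // lowering1 // (x_nadm _ irs) (x_nadm _ irrs).
  by rewrite !(scaler0, lie0r, addr0).
have L5 := lowering1 jrrr; move: L5; rewrite p2 => L5.
by rewrite /= L3 lieZr L4 !lieZr L5 !scalerA; congr (_ *: _).
Qed.

End Crossing.

(** With r the smallest admissible degree of j, up to sign, the translation moves the degree at i by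
    (p + 1) r, exactly one step of its lattice. The intermediate multiples of r fall outside this
    lattice, as [spread2] and [spread3] require. *)
Lemma spread_crossing i j (p : nat) : i != j -> ~~ special_node d j ->
  (p == 1)%N || (p == 2)%N ->
  cartan X (fnode j) (fnode i) = - p.+1%:Z -> dtilde d i = (p.+1 * dtilde d j)%N ->
  (0 < dtilde d j)%N -> all_in j -> (forall u, G (x u i 0)) -> all_in i.
Proof.
move=> ij nsp p12 cp dd dj Gj Gi u m /dvdzP[k ->].
have kadm (c : int) : adm i (c * (dtilde d i)%:Z) by exact: dvdz_mull.
have jr (e : bool) : adm j ((-1) ^+ e * (dtilde d j)%:Z) by exact: dvdz_mull.
have nadm (e : bool) n c : (0 < n <= p)%N ->
    ~~ adm i ((-1) ^+ e * (n * dtilde d j)%:Z + c * (dtilde d i)%:Z).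
  move=> /andP[n0 np]; rewrite /adm /drinfeld_deg rpredDr; last exact: kadm.
  rewrite dvdzE abszM abszX exp1n mul1n /=; apply/negP => /dvdn_leq; rewrite muln_gt0 n0 dj => /(_ isT).
  by rewrite dd leq_pmul2r // leqNgt ltnS np.
have step (e : bool) c : G (x u i (c * (dtilde d i)%:Z)) ->
    G (x u i ((c + (-1) ^+ e) * (dtilde d i)%:Z)).
  have n1 := nadm e 1%N c; rewrite mul1n in n1.
  case/orP: p12 => /eqP p12 Gs.
    have := @spread2 i j p u (~~ u) _ _ erefl ij nsp cp (jr e) (kadm c) _ p12 Gj Gs.
    rewrite (_ : _ + _ + _ = (c + (-1) ^+ e) * (dtilde d i)%:Z); last first.
      by rewrite dd p12; lia.
    by apply; apply: n1; rewrite p12.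
  have := @spread3 i j p u (~~ u) _ _ erefl ij nsp cp (jr e) (kadm c) _ p12 _ Gj Gs.
  rewrite (_ : _ + (_ + _) + _ = (c + (-1) ^+ e) * (dtilde d i)%:Z); last first.
    by rewrite dd p12; lia.
  apply; first by apply: n1; rewrite p12.
  rewrite (_ : _ + _ + _ = (-1) ^+ e * (2 * dtilde d j)%:Z + c * (dtilde d i)%:Z); last lia.
  by apply: nadm; rewrite p12.
elim/int_step_ind: k => [|k Gk|k Gk]; first by rewrite mul0r.
  exact: (step false).
exact: (step true).
Qed.

(** * The node 1 of type A_{2n}^(2), where twice a real root plus an odd multiple of delta is a
    root *)

Section Special.
Variable i : 'I_(rank X).
Hypotheses (sp : special_node d i) (i1 : fnode i = 1%N :> nat).

Let admT k r : adm k r.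
Proof.
by rewrite /adm /drinfeld_deg /dtilde; case/andP: sp => -> _; rewrite orbT dvd1z.
Qed.

Let sgz (r : int) : rat := ((-1) ^ r)%:~R.
Let sgzD e r : e = 1 \/ e = -1 -> sgz (e + r) = - sgz r.
Proof.
rewrite /sgz exprzDr ?unitrN1 // => -[] ->; last by rewrite exprN1 invrN1 mulN1r mulrNz.
by rewrite expr1z mulN1r mulrNz.
Qed.
Let sgz_sign r : exists b : bool, sgz r = (-1) ^+ b.
Proof.
elim/int_step_ind: r => [|r [b E]|r [b E]]; first by exists false.
  by exists (~~ b); rewrite addrC sgzD ?E; [case: b E | left].
by exists (~~ b); rewrite addrC sgzD ?E; [case: b E | right].
Qed.
Let sgz0 : sgz 0 = 1. Proof. by []. Qed.

(** That is 2 in even degrees and 6 in odd degrees. *)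
Lemma a_special r : a i i r = 4 - 2 * sgz r.
Proof.
rewrite /a /loop_cartan sp eqxx exprzDr ?unitrN1 // exprN1 invrN1 mulrN1.
by rewrite rmorphM rmorphB /= !rmorph_nat -/(sgz r); ring.
Qed.

Lemma lie_triple u r s t : ⟦x u i r, ⟦x u i s, x u i t⟧⟧ = 0.
Proof.
by case: rel => _ [_ [_ [_ [_ [_ [_ [_ [_ [R _]]]]]]]]]; apply: R.
Qed.

(** Root vector for 2 alpha_i + e delta or -2 alpha_i + e delta, according to the sign u; it is used
    for e = 1 and e = -1. *)
Definition long_vec u (e : int) := ⟦x u i 0, x u i e⟧.

Lemma lie_long_same u e r : ⟦long_vec u e, x u i r⟧ = 0.
Proof. by rewrite lieC lie_triple oppr0. Qed.

Section LongRoot.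
Variables (u w : bool) (e : int).
Hypotheses (uw : w = ~~ u) (e1 : e = 1 \/ e = -1).
Let wu : u = ~~ w := negb_swap uw.

Lemma lie_long_opp r : ⟦long_vec u e, x w i r⟧ = (- 4 * sgz r) *: x u i (e + r).
Proof.
rewrite lie_nested [⟦x u i 0, _⟧]lieC lie_coroot // [⟦x u i e, _⟧]lieC lie_coroot //.
rewrite sg_same !mul1r opprK !a_special !add0r addr0 [r + e]addrC sgzD //.
by rewrite -scaleNr -scalerDl; congr (_ *: _); ring.
Qed.

(** The factors 4^-1 and the sign normalize the two long vectors to an sl2 pair. The coroot of 2
    alpha_i is half that of alpha_i, whence the factor 2^-1. *)
Lemma lie_long_coroot v j t :
  ⟦⟦4^-1 *: long_vec u e, - (4^-1 *: long_vec w (- e))⟧, x v j t⟧ =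
  (2^-1 * ((-1) ^+ u * (-1) ^+ v * a i j 0)) *: x v j t.
Proof.
rewrite lieNr lieNl lieZl lieZr !lieZl [long_vec w _]/long_vec lie_derivation.
rewrite !lie_long_opp lieZl lieZr lieDl !lieZl !lie_coroot // subrr !add0r addr0.
have -> : sgz (- e) = -1.
  by have := sgzD 0 (e := - e); rewrite addr0 sgz0; apply; case: e1 => ->; [right|left]; rewrite ?opprK.
rewrite sgz0 uw signrN !subrr !add0r !(scalerA, =^~ scalerDl, =^~ scaleNr).
by congr (_ *: _); field.
Qed.

Lemma lie_long_coroot_long :
  ⟦⟦4^-1 *: long_vec u e, - (4^-1 *: long_vec w (- e))⟧, 4^-1 *: long_vec u e⟧ =
  2 *: (4^-1 *: long_vec u e).
Proof.
rewrite lieZr [X in ⟦_, X⟧]/long_vec lie_derivation !lie_long_coroot lieZl lieZr.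
rewrite -scalerDl !scalerA sg_same a_special sgz0 -/(long_vec u e).
by congr (_ *: _).
Qed.

(** The reflection in 2 alpha + e delta sends -alpha + r delta to alpha + (e + r) delta, so the
    degree moves by one only. *)
Lemma reflect_long r : G (4^-1 *: long_vec u e) -> G (4^-1 *: long_vec w (- e)) ->
  G (x w i r) -> G (x u i (e + r)).
Proof.
move=> Gu Gw Gr.
have Ez : ⟦4^-1 *: long_vec u e, x w i r⟧ = (- sgz r) *: x u i (e + r).
  by rewrite lieZl lie_long_opp scalerA; congr (_ *: _); field.
have : G ((1`!%:R)^-1 *: iter 1 (lie (4^-1 *: long_vec u e)) (x w i r)).
  apply: (G_reflection (F := - (4^-1 *: long_vec w (- e)))) => //.
  - exact: lie_long_coroot_long.
  - by rewrite lieNl lieZl lie_long_same scaler0 oppr0.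
  - rewrite lie_long_coroot (sg_opp' uw) a_special sgz0; congr (_ *: _).
  - by rewrite /= Ez lieZr lieZl lie_long_same !scaler0.
  - exact: G_opp.
rewrite /= Ez scalerA mul1r; case: (sgz_sign r) => -[] -> /=.
  by rewrite opprK scale1r.
exact: G_scale_opp.
Qed.

(** Reflection in a degree 0 root of node i. The long vector has weight -4, so p = 4, and the
    coefficient -6 / 4! is -4^-1: the normalization is preserved up to sign. *)
Lemma flip_long : (forall v, G (x v i 0)) ->
  G (4^-1 *: long_vec u e) -> G (4^-1 *: long_vec w e).
Proof.
move=> G0 Gu; apply: G_scale_opp.
have se : sgz e = -1 by have := sgzD 0 e1; rewrite addr0 sgz0.
have E1 : ⟦x w i 0, long_vec u e⟧ = 4 *: x u i e.
  by rewrite lieC lie_long_opp addr0 sgz0 -scaleNr; congr (_ *: _).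
have E3 : ⟦x w i 0, ⟦x w i 0, x u i e⟧⟧ = - 6 *: x w i e.
  rewrite [LHS]lieC lie_coroot // sg_same a_special !add0r se addr0 -scaleNr.
  by congr (_ *: _).
have E4 : iter 4 (lie (x w i 0)) (4^-1 *: long_vec u e) = - 6 *: long_vec w e.
  by rewrite iter_lieZ /= E1 !lieZr E3 !lieZr !scalerA; congr (_ *: _).
have : G ((4`!%:R)^-1 *: iter 4 (lie (x w i 0)) (4^-1 *: long_vec u e)).
  apply: (G_reflection (F := x u i 0)) => //.
  - by rewrite lie_coroot // sg_same a_special !addr0 sgz0.
  - by rewrite lieZr lie_triple scaler0.
  - rewrite lieZr {1}/long_vec lie_derivation !lie_coroot // lieZl lieZr !add0r -scalerDl.
    by rewrite !scalerA (sg_opp uw) a_special sgz0; congr (_ *: _).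
  - by rewrite iterS E4 lieZr lie_triple scaler0.
by rewrite E4 !scalerA; congr (G (_ *: _)).
Qed.

End LongRoot.

(** The two given long vectors produce the other two by [flip_long]; reflections in the four of them
    then shift the degree by 1 or -1. *)
Lemma rank1_special : (forall v, G (x v i 0)) ->
  G (4^-1 *: long_vec true 1) -> G (4^-1 *: long_vec false (-1)) ->
  (forall u (e : bool), G (4^-1 *: long_vec u ((-1) ^+ e))) /\ all_in i.
Proof.
move=> G0 G1 Gm1.
have GY u (e : bool) : G (4^-1 *: long_vec u ((-1) ^+ e)).
  case: u e => [] [] //; [apply: (@flip_long false true)|apply: (@flip_long true false)] => //.
    by right.
  by left.
split=> // u r _; move: r u.
have step (e : bool) r u : (forall v, G (x v i r)) -> G (x u i ((-1) ^+ e + r)).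
  move=> Gr; apply: (@reflect_long u (~~ u)) => //; first by case: e; [right|left].
  by have := GY (~~ u) (~~ e); case: e; rewrite ?opprK.
elim/int_step_ind => // r Gr u; rewrite addrC.
  exact: (step false).
exact: (step true).
Qed.

(** * From the special node to its neighbour *)

Section SpreadSpecial.
Variables (k : 'I_(rank X)) (u w : bool) (e s : int).
Hypotheses (uw : w = ~~ u) (e1 : e = 1 \/ e = -1).
Hypotheses (ki : k != i) (cp : cartan X (fnode i) (fnode k) = - 2%:Z).
Let ik : i != k. Proof. by rewrite eq_sym. Qed.
Let wu : u = ~~ w := negb_swap uw.

(** Write X0, z for the factors and Y for the long vector. Applying h to (ad X0)^3 z = 0 yields 18
    times the relation [A0]; bracketing [A0] with X0, which commutes with Y, shows that the wanted
    bracket equals its own opposite. *)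
Lemma long_polarized_serre f : f = 1 \/ f = -1 ->
  ⟦long_vec u f, ⟦x u i 0, ⟦x u i 0, x u k s⟧⟧⟧ = 0.
Proof.
move=> f1; set z := x u k s; set X0 := x u i 0; set Y := long_vec u f.
have Z3 t : ⟦X0, ⟦X0, ⟦X0, x u k t⟧⟧⟧ = 0 by exact: serre ik _ _ cp.
have sf : sgz f = -1 by have := sgzD 0 f1; rewrite addr0 sgz0.
pose h := ⟦x u i 0, x w i f⟧.
have hX : ⟦h, X0⟧ = 6 *: x u i f.
  rewrite lie_coroot // sg_same a_special add0r sf addr0; congr (_ *: _).
have hz : ⟦h, z⟧ = - 2 *: x u k (f + s).
  by rewrite lie_coroot // sg_same (a_neq _ ik cp) mul1r add0r.
have XY q : ⟦X0, ⟦Y, q⟧⟧ = ⟦Y, ⟦X0, q⟧⟧.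
  by rewrite lie_derivation lie_triple lie0l add0r.
have Xf q : ⟦X0, ⟦x u i f, q⟧⟧ = ⟦Y, q⟧ + ⟦x u i f, ⟦X0, q⟧⟧ by exact: lie_derivation.
have A0 : ⟦x u i f, ⟦X0, ⟦X0, z⟧⟧⟧ = - ⟦Y, ⟦X0, z⟧⟧.
  have T1 := Xf ⟦X0, z⟧.
  have T2 : ⟦X0, ⟦X0, ⟦x u i f, z⟧⟧⟧ =
      ⟦Y, ⟦X0, z⟧⟧ + (⟦Y, ⟦X0, z⟧⟧ + ⟦x u i f, ⟦X0, ⟦X0, z⟧⟧⟧).
    by rewrite Xf lieDr XY Xf.
  have := congr1 (lie h) (Z3 s); rewrite lie0r !(lie_derivation h X0) hX hz.
  rewrite !(lieZl, lieZr, lieDr) Z3 !scaler0 addr0 T1 T2.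
  move: ⟦x u i f, _⟧ ⟦Y, _⟧ => A B E.
  apply/eqP; rewrite -addr_eq0; apply/eqP/(@scalerI _ _ 18) => //.
  rewrite scaler0 -E !scalerDr !addrA (ACl (1*3*6*(2*4*5))%AC) /=.
  by rewrite -!scalerDl.
have := congr1 (lie X0) A0; rewrite Xf Z3 lie0r addr0 lieNr XY => /eqP.
by rewrite -addr_eq0 -mulr2n -scaler_nat scaler_eq0 /= => /eqP.
Qed.

Lemma lie_long_other : ⟦long_vec w e, x u k s⟧ = 0.
Proof.
by rewrite lie_nested !(lie_x_opp wu ik) // !lie0r subrr.
Qed.

Lemma lie_long_raised :
  ⟦long_vec w e, ⟦x u i 0, ⟦x u i 0, x u k s⟧⟧⟧ = - 8 *: x u k (e + s).
Proof.
have Y0 : ⟦long_vec w e, x u i 0⟧ = - 4 *: x w i e.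
  by rewrite lie_long_opp // sgz0 mulr1 addr0.
have xz : ⟦x w i e, x u k s⟧ = 0 by rewrite (lie_x_opp wu ik).
rewrite !(lie_derivation (long_vec w e)) Y0 lie_long_other !lieZl xz scaler0 lie0r addr0 lie0r addr0.
rewrite (lie_derivation (x w i e)) xz lie0r addr0 lie_coroot // (sg_opp uw) (a_neq _ ik cp) addr0.
by rewrite scalerA; congr (_ *: _); ring.
Qed.

(** Translation by one step: the reflection in alpha_i raises [x u k s] by 2 alpha_i, and the
    reflection in a long root of degree e takes 2 alpha_i off again while adding e delta. *)
Lemma spread_special : (forall v, G (x v i 0)) ->
  (forall v (b : bool), G (4^-1 *: long_vec v ((-1) ^+ b))) ->
  G (x u k s) -> G (x u k (e + s)).
Proof.
move=> G0 GY Gs.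
have GYe v : G (4^-1 *: long_vec v e).
  by case: e1 => ->; [exact: (GY v false)|exact: (GY v true)].
have GYNe v : G (4^-1 *: long_vec v (- e)).
  by case: e1 => ->; rewrite ?opprK; [exact: (GY v true)|exact: (GY v false)].
pose v := (2`!%:R)^-1 *: iter 2 (lie (x u i 0)) (x u k s).
have Gv : G v.
  apply: (G_reflection (F := x w i 0)) => //.
  - by rewrite lie_coroot // sg_same a_special !addr0 sgz0; congr (_ *: _).
  - by rewrite (lie_x_opp wu ik).
  - by rewrite lie_coroot // sg_same (a_neq _ ik cp) !add0r mul1r.
  - exact: serre ik _ _ cp.
have Ev : ⟦4^-1 *: long_vec w e, v⟧ = - 1 *: x u k (e + s).
  by rewrite lieZl lieZr /= lie_long_raised !scalerA; congr (_ *: _).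
have : G ((1`!%:R)^-1 *: iter 1 (lie (4^-1 *: long_vec w e)) v).
  apply: (G_reflection (F := - (4^-1 *: long_vec u (- e)))) => //.
  - exact: lie_long_coroot_long.
  - rewrite lieNl lieZl lieZr long_polarized_serre ?scaler0 ?oppr0 //.
    by case: e1 => ->; [right|left]; rewrite ?opprK.
  - set H := ⟦_, - _⟧.
    have HX : ⟦H, x u i 0⟧ = - x u i 0.
      rewrite lie_long_coroot // (sg_opp uw) a_special sgz0 -scaleN1r; congr (_ *: _).
    have Hz : ⟦H, x u k s⟧ = x u k s.
      rewrite lie_long_coroot // (sg_opp uw) (a_neq _ ik cp) -[RHS]scale1r; congr (_ *: _).
    rewrite lieZr /= !(lie_derivation H (x u i 0)) HX Hz !lieNl addNr lie0r addr0.
    by rewrite scalerN [RHS]scaleN1r.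
  - by rewrite !iterS /= Ev !(lieZl, lieZr) lie_nested !(lie_x_opp wu ik) // !lie0r subrr !scaler0.
  - exact: G_opp.
by rewrite /= Ev scalerA mul1r; apply: G_scale_opp.
Qed.

End SpreadSpecial.

Lemma spread_special_all k : k != i -> cartan X (fnode i) (fnode k) = - 2%:Z ->
  (forall v, G (x v i 0)) ->
  (forall v (b : bool), G (4^-1 *: long_vec v ((-1) ^+ b))) ->
  (forall v, G (x v k 0)) -> all_in k.
Proof.
move=> ki cp G0 GY Gk u r _; move: u.
elim/int_step_ind: r => // r Gr u; rewrite addrC.
  by apply: (@spread_special k u (~~ u)) => //; left.
by apply: (@spread_special k u (~~ u)) => //; right.
Qed.

End Special.

End LoopReflections.

(** * Lengths of the roots conjugate to theta *)

Section RootNorm.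
Variables (X : affine_type) (d : 'I_(rank X).+1 -> nat).
Hypothesis hd : min_symmetrizer (cartan X) d.

Let c i j := cartan X (fnode i) (fnode j).
Let D i : int := (d (fnode i))%:Z.
Implicit Types (i j : 'I_(rank X)) (b t : 'rV[int]_(rank X)).

(** The integer <b, alpha_i^vee>. In [root_form] it is weighted by d_i, which gives the symmetric
    Weyl-invariant form. *)
Definition pairing b i : int := \sum_j b 0 j * c i j.
Definition root_form b b' : int := \sum_i D i * b 0 i * pairing b' i.

Let Dc i j : D i * c i j = D j * c j i.
Proof. by case: hd => H _ _; exact: H. Qed.

Let D_ge0 i : 0 <= D i. Proof. by []. Qed.

Lemma root_formC b b' : root_form b b' = root_form b' b.
Proof.
rewrite /root_form /pairing; under eq_bigr do rewrite mulr_sumr.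
rewrite exchange_big; apply: eq_bigr => i _; rewrite mulr_sumr; apply: eq_bigr => j _.
transitivity (b 0 j * b' 0 i * (D j * c j i)); first by ring.
by rewrite -Dc; ring.
Qed.

Lemma root_normE b : root_norm d b = root_form b b.
Proof.
apply: eq_bigr => i _; rewrite mulr_sumr; apply: eq_bigr => j _.
by rewrite /D /c; ring.
Qed.

Lemma simple_rootE i j : simple_root i 0 j = (j == i)%:R.
Proof. by rewrite mxE eqxx. Qed.

Lemma pairing_simple i j : pairing (simple_root i) j = c j i.
Proof.
rewrite /pairing (bigD1 i) //= simple_rootE eqxx mul1r big1 ?addr0 // => k ki.
by rewrite simple_rootE (negPf ki) mul0r.
Qed.

Lemma root_form_simple i b : root_form (simple_root i) b = D i * pairing b i.
Proof.
rewrite /root_form (bigD1 i) //= simple_rootE eqxx mulr1 big1 ?addr0 // => k ki.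
by rewrite simple_rootE (negPf ki) mulr0 mul0r.
Qed.

Lemma root_formBl b b' t : root_form (b - b') t = root_form b t - root_form b' t.
Proof.
rewrite /root_form -sumrB; apply: eq_bigr => i _; rewrite !mxE; ring.
Qed.

Lemma root_formZl k b t : root_form (k *: b) t = k * root_form b t.
Proof.
rewrite /root_form mulr_sumr; apply: eq_bigr => i _; rewrite !mxE; ring.
Qed.

Lemma root_norm_refl i b : root_norm d (simple_refl i b) = root_norm d b.
Proof.
rewrite !root_normE /simple_refl -/(pairing b i).
rewrite root_formBl !(root_formC _ (b - _)) !root_formBl root_formZl !(root_formC _ (_ *: _)).
rewrite !root_formZl (root_formC _ (_ *: _)) root_formZl !root_form_simple pairing_simple.
have -> : c i i = 2 by rewrite /c mxE eqxx.
ring.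
Qed.

Lemma root_norm_conj w j : root_norm d (foldr (@simple_refl X) (simple_root j) w) = 2 * D j.
Proof.
elim: w => [|i w IH] /=; last by rewrite root_norm_refl.
rewrite root_normE root_form_simple pairing_simple.
have -> : c j j = 2 by rewrite /c mxE eqxx.
by rewrite mulrC.
Qed.

Lemma root_norm_simple j : root_norm d (simple_root j) = 2 * D j.
Proof. exact: (root_norm_conj [::]). Qed.

Lemma fin_roots_simple j : fin_roots X (simple_root j).
Proof. by exists [::], j. Qed.

Lemma fin_roots_refl i b : fin_roots X b -> fin_roots X (simple_refl i b).
Proof. by move=> [w [j ->]]; exists (i :: w), j. Qed.

(** Reflections preserve the norm, so t has the norm 2 d_j of alpha_j, to be compared with the norm
    2 d_i of alpha_i. *)
Lemma short_theta t w j : highest_in (short_roots d) t ->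
  t = foldr (@simple_refl X) (simple_root j) w -> forall i, (d (fnode j) <= d (fnode i))%N.
Proof.
move=> [[_ tmin] _] tw i; have := tmin _ (fin_roots_simple i).
rewrite tw root_norm_conj root_norm_simple /D.
by lia.
Qed.

(** * The highest root is a longest root *)

Definition dominant b := forall i, 0 <= pairing b i.
Definition height b : int := \sum_i b 0 i.

Lemma height_refl i b : height (simple_refl i b) = height b - pairing b i.
Proof.
rewrite /height /simple_refl -/(pairing b i).
rewrite (eq_bigr (fun k => b 0 k - pairing b i * (k == i)%:R)); last first.
  by move=> k _; rewrite !mxE eqxx.
rewrite sumrB; congr (_ - _); rewrite (bigD1 i) //= eqxx mulr1 big1 ?addr0 // => k /negPf ->.
by rewrite mulr0.
Qed.

Section Highest.
Variable t : 'rV[int]_(rank X).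
Hypothesis ht : highest_in (fin_roots X) t.

(** Otherwise a simple reflection would increase a coordinate of t. *)
Lemma highest_dominant : dominant t.
Proof.
case: ht => tr tmax i; have := tmax _ (fin_roots_refl i tr) i.
by rewrite /simple_refl -/(pairing t i) !mxE !eqxx mulr1 gerBl.
Qed.

(** While some pairing is negative, the corresponding reflection increases the height, which the
    height of t bounds. *)
Lemma exists_dominant b : fin_roots X b ->
  exists b', [/\ fin_roots X b', root_norm d b' = root_norm d b & dominant b'].
Proof.
have [n] := ubnP `|height t - height b|%N; elim: n b => // n IH b bn br.
have [bd|/existsNP[i /negP]] := pselect (dominant b); first by exists b.
rewrite -ltNge => bi; have sr := fin_roots_refl i br.
have le_ht b' : fin_roots X b' -> height b' <= height t.
  by case: ht => _ tmax b'r; apply: ler_sum => k _; apply: tmax.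
have [|b' [b'r b'n b'd]] := IH (simple_refl i b) _ sr.
  have := le_ht _ sr; have := le_ht _ br; rewrite height_refl => h1 h2; lia.
by exists b'; rewrite b'n root_norm_refl.
Qed.

(** For b' dominant of the same norm as b, (t,t) - (b',b') = (t - b', t) + (t - b', b'). Both terms
    are nonnegative: t - b' has nonnegative coordinates, and t and b' are dominant. *)
Lemma highest_longest b : fin_roots X b -> root_norm d b <= root_norm d t.
Proof.
move=> /exists_dominant[b' [b'r <- b'd]]; rewrite !root_normE -subr_ge0.
have -> : root_form t t - root_form b' b' = root_form (t - b') t + root_form (t - b') b'.
  by rewrite !root_formBl (root_formC b' t); ring.
rewrite /root_form -big_split; apply: sumr_ge0 => i _ /=; rewrite -mulrDr mulr_ge0 //.
  by rewrite mulr_ge0 // !mxE subr_ge0; case: ht => _; apply.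
by rewrite addr_ge0 // ?b'd // highest_dominant.
Qed.

End Highest.

Lemma long_theta t w j : highest_in (fin_roots X) t ->
  t = foldr (@simple_refl X) (simple_root j) w -> forall i, (d (fnode i) <= d (fnode j))%N.
Proof.
move=> ht tw i; have := highest_longest ht (fin_roots_simple i).
rewrite tw root_norm_conj root_norm_simple /D.
by lia.
Qed.

End RootNorm.

(** * Propagation along the affine diagrams *)

Fixpoint edge_weight (s : seq (nat * nat * nat * nat)) (k l : nat) : nat :=
  if s is (k', l', p, q) :: s' then
    ((k' == k) && (l' == l)) * p + ((k' == l) && (l' == k)) * q + edge_weight s' k l
  else 0.

(** Nodes are plain natural numbers here, so that [lia] can decide the entries of a whole family at
    once. *)
Definition nat_cartan X (k l : nat) : int :=
  if k == l then 2 else - (edge_weight (dynkin X) k l)%:Z.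

Lemma cartan_nat X i j : cartan X i j = nat_cartan X i j.
Proof.
rewrite mxE /nat_cartan; case: eqP => [->|/eqP ij]; first by rewrite eqxx.
rewrite -val_eqE in ij; rewrite (negPf ij); congr (- (_ %:Z)).
elim: (dynkin X) => [|[[[k l] p] q] s IH] /=; first by rewrite big_nil.
by rewrite big_cons IH.
Qed.

Lemma edge_weight_cat s1 s2 k l :
  edge_weight (s1 ++ s2) k l = (edge_weight s1 k l + edge_weight s2 k l)%N.
Proof. by elim: s1 => [|[[[k' l'] p] q] s IH] //=; rewrite IH !addnA. Qed.

Lemma edge_weight_chain a b k l : edge_weight (chain a b) k l =
  ((a <= k < b) && (l == k.+1) + (a <= l < b) && (k == l.+1))%N.
Proof.
rewrite /chain; have [ab|ba] := leqP a b; last first.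
  by rewrite (_ : (b - a)%N = 0%N) /=; lia.
have [m ->] : exists m, b = (a + m)%N by exists (b - a)%N; rewrite subnKC.
by rewrite addKn {ab}; elim: m a => [|m IH] a /=; [lia | rewrite IH; lia].
Qed.

Lemma edge_weight1 i j p q k l : edge_weight [:: (i, j, p, q)] k l =
  (((i == k) && (j == l)) * p + ((i == l) && (j == k)) * q)%N.
Proof. by rewrite /= addn0. Qed.

Definition edge_weightE := (edge_weight_cat, edge_weight_chain, edge_weight1).

Lemma nat_cartan_neq X k l : k != l ->
  nat_cartan X k l = - (edge_weight (dynkin X) k l)%:Z.
Proof. by rewrite /nat_cartan => /negPf ->. Qed.

Lemma chain_spread (P : nat -> Prop) a b :
  (forall k, (a <= k < b)%N -> P k -> P k.+1) ->
  (forall k, (a <= k < b)%N -> P k.+1 -> P k) ->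
  forall k l, (a <= k <= b)%N -> (a <= l <= b)%N -> P k -> P l.
Proof.
move=> up down k l kab lab Pk.
have Pa : P a.
  have [m E] : exists m, k = (a + m)%N by exists (k - a)%N; lia.
  rewrite E in Pk kab; elim: m {E} kab Pk => [|m IH] mb; first by rewrite addn0.
  by rewrite addnS => Pm; apply: IH; [lia | apply: down => //; lia].
have [m E] : exists m, l = (a + m)%N by exists (l - a)%N; lia.
rewrite E in lab *; elim: m {E} lab => [|m IH] mb; first by rewrite addn0.
by rewrite addnS; apply: up; [lia | apply: IH; lia].
Qed.

Definition simple_pair X k l := nat_cartan X k l = -1 /\ nat_cartan X l k = -1.
(** The first node k is the long one: a symmetrizer has d_k = m d_l. *)
Definition arrow_pair X (m k l : nat) :=
  nat_cartan X k l = -1 /\ nat_cartan X l k = - m%:Z.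

Ltac edges := rewrite /simple_pair /arrow_pair !nat_cartan_neq
  /dynkin /simple_edge /arrow ?edge_weightE; lia.

(** * Edges of the individual diagrams *)

Lemma A1_chain m k : (1 <= k < m)%N -> simple_pair (A1 m) k k.+1.
Proof.
move=> km; have m1 : (m == 1%N) = false by lia.
by rewrite /simple_pair !nat_cartan_neq /dynkin ?m1 ?edge_weightE; lia.
Qed.

Lemma B1_chain m k : (1 <= k < m.-1)%N -> simple_pair (B1 m) k k.+1.
Proof. by move=> km; edges. Qed.
Lemma B1_arrow m : (3 <= m)%N -> arrow_pair (B1 m) 2 m.-1 m.
Proof. by move=> m3; edges. Qed.

Lemma C1_chain m k : (1 <= k < m.-1)%N -> simple_pair (C1 m) k k.+1.
Proof. by move=> km; edges. Qed.
Lemma C1_arrow m : (2 <= m)%N -> arrow_pair (C1 m) 2 m m.-1.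
Proof. by move=> m2; edges. Qed.

Lemma D1_chain m k : (1 <= k < m.-1)%N -> simple_pair (D1 m) k k.+1.
Proof. by move=> km; edges. Qed.
Lemma D1_fork m : (4 <= m)%N -> simple_pair (D1 m) m.-2 m.
Proof. by move=> m4; edges. Qed.

Lemma E61_chain k : (1 <= k < 5)%N -> simple_pair E61 k k.+1.
Proof. by move: k; do 6!case=> //. Qed.
Lemma E71_chain k : (1 <= k < 6)%N -> simple_pair E71 k k.+1.
Proof. by move: k; do 7!case=> //. Qed.
Lemma E81_chain k : (1 <= k < 7)%N -> simple_pair E81 k k.+1.
Proof. by move: k; do 8!case=> //. Qed.

Lemma A2odd_chain m k : (1 <= k < m.-1)%N -> simple_pair (A2odd m) k k.+1.
Proof. by move=> km; edges. Qed.
Lemma A2odd_arrow m : (3 <= m)%N -> arrow_pair (A2odd m) 2 m m.-1.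
Proof. by move=> m3; edges. Qed.
Lemma A2odd_affine m : (3 <= m)%N -> simple_pair (A2odd m) 0 2.
Proof. by move=> m3; edges. Qed.

Lemma D2_chain m k : (1 <= k < m.-1)%N -> simple_pair (D2 m) k k.+1.
Proof. by move=> km; edges. Qed.
Lemma D2_arrow m : (2 <= m)%N -> arrow_pair (D2 m) 2 m.-1 m.
Proof. by move=> m3; edges. Qed.
Lemma D2_affine m : (2 <= m)%N -> arrow_pair (D2 m) 2 1 0.
Proof. by move=> m3; edges. Qed.

Lemma A2even_chain m k : (2 <= k < m)%N -> simple_pair (A2even m) k k.+1.
Proof.
move=> km; have m1 : (m == 1%N) = false by lia.
by rewrite /simple_pair !nat_cartan_neq /dynkin ?m1 ?edge_weightE; lia.
Qed.
Lemma A2even_arrow m : (2 <= m)%N -> arrow_pair (A2even m) 2 2 1.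
Proof.
move=> km; have m1 : (m == 1%N) = false by lia.
by rewrite /arrow_pair !nat_cartan_neq /dynkin ?m1 ?edge_weightE; lia.
Qed.
Lemma A2even_affine m : (2 <= m)%N -> arrow_pair (A2even m) 2 0 m.
Proof.
move=> km; have m1 : (m == 1%N) = false by lia.
by rewrite /arrow_pair !nat_cartan_neq /dynkin ?m1 ?edge_weightE; lia.
Qed.

(** * Symmetrizers read off the diagrams *)

Section DiagramSymmetrizer.
Variables (X : affine_type) (dn : nat -> nat).
Local Notation n := (rank X).
Hypothesis dn_sym : forall k l, (k <= n)%N -> (l <= n)%N ->
  (dn k)%:Z * nat_cartan X k l = (dn l)%:Z * nat_cartan X l k.

Lemma dn_arrow m k l : (k <= n)%N -> (l <= n)%N ->
  arrow_pair X m k l -> dn k = (m * dn l)%N.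
Proof.
by move=> kn ln [kl lk]; have := dn_sym kn ln; rewrite kl lk; lia.
Qed.

Lemma dn_simple k l : (k <= n)%N -> (l <= n)%N -> simple_pair X k l -> dn k = dn l.
Proof. by move=> kn ln kl; rewrite (@dn_arrow 1 k l) // mul1n. Qed.

Lemma dn_chain a b : (b <= n)%N ->
  (forall k, (a <= k < b)%N -> simple_pair X k k.+1) ->
  forall k l, (a <= k <= b)%N -> (a <= l <= b)%N -> dn k = dn l.
Proof.
move=> bn edge k l kab lab.
have E m : (a <= m < b)%N -> dn m = dn m.+1.
  by move=> mab; apply: dn_simple (edge _ mab); lia.
by apply: (@chain_spread (fun m => dn k = dn m) a b _ _ k) => // m mab; rewrite (E m mab).
Qed.
(** The edges express every d_k as a multiple of d_1, so the value 1 can only be attained at node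
    1. *)
Lemma A2even_symmetrizer : affine_ok X -> is_A2even X ->
  (exists2 k, (k <= rank X)%N & dn k = 1%N) ->
  dn 1%N = 1%N /\ forall k, (2 <= k <= rank X)%N -> dn k = 2%N.
Proof.
move: dn_arrow dn_chain; case: X => //= m arr chain ok _ [k km dk].
have [m1|m2] : m = 1%N \/ (2 <= m)%N by lia.
  have D0 : dn 0%N = (4 * dn 1)%N.
    by apply: arr => //; rewrite m1.
  by split=> [|l]; [have [kE|kE] : k = 0%N \/ k = 1%N by lia|]; [rewrite kE in dk| rewrite kE in dk |]; lia.
have D2 : dn 2%N = (2 * dn 1)%N by apply: arr (A2even_arrow m2); lia.
have D0 : dn 0%N = (2 * dn m)%N by apply: arr (A2even_affine m2); lia.
have ch l : (2 <= l <= m)%N -> dn l = dn 2%N.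
  by move=> lm; apply: (chain 2%N m (leqnn m) (@A2even_chain m)); lia.
have D1 : dn 1%N = 1%N.
  have [kE|[kE|kE]] : k = 0%N \/ k = 1%N \/ (2 <= k)%N by lia.
  - by rewrite kE in dk; lia.
  - by rewrite kE in dk.
  - by have := ch k; lia.
by split=> // l lm; rewrite ch // D2 D1.
Qed.

End DiagramSymmetrizer.

Lemma spread_chain X (P : nat -> Prop) a b : (1 <= a)%N -> (b <= rank X)%N ->
  (forall k l, (1 <= k <= rank X)%N -> (1 <= l <= rank X)%N -> k != l ->
    simple_pair X k l -> P k -> P l) ->
  (forall k, (a <= k < b)%N -> simple_pair X k k.+1) ->
  forall k l, (a <= k <= b)%N -> (a <= l <= b)%N -> P k -> P l.
Proof.
move=> a1 bn step edge; apply: chain_spread => k kab; have [e1 e2] := edge k kab.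
  by apply: step => //; lia.
by apply: step => //; lia.
Qed.

(** * Reaching all finite nodes from a longest or a shortest one *)

Section Propagation.
Variables (X : affine_type) (dn : nat -> nat) (P : nat -> Prop) (j : nat).
Hypothesis okX : affine_ok X.
Hypothesis dn_gt0 : forall k, (k <= rank X)%N -> (0 < dn k)%N.
Hypothesis dn_sym : forall k l, (k <= rank X)%N -> (l <= rank X)%N ->
  (dn k)%:Z * nat_cartan X k l = (dn l)%:Z * nat_cartan X l k.
Hypothesis jn : (1 <= j <= rank X)%N.
(** The minimum 1 might be attained at node 0, but in each of these diagrams some finite node is
    just as short. This makes [dtilde d j] equal to 1, so that all degrees are admissible at j. *)
Lemma affine_short_node : twist X <> 1%N -> ~~ is_A2even X ->
  (forall k, (1 <= k <= rank X)%N -> (dn j <= dn k)%N) ->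
  (exists2 k, (k <= rank X)%N & dn k = 1%N) -> dn j = 1%N.
Proof.
move=> tw nA short_j [k kn dk1].
suff [l ln lk] : exists2 l, (1 <= l <= rank X)%N & (dn l <= dn k)%N.
  have := short_j l ln; have := dn_gt0 (k := j); lia.
have [k0|k1] : k = 0%N \/ (1 <= k)%N by lia.
  2: by exists k => //; lia.
rewrite k0 {k k0 kn dk1}.
move: tw nA okX (dn_simple dn_sym) (dn_arrow dn_sym) (dn_chain dn_sym).
case: X => [m|m|m|m| | | | | |m|m|m| |] //= _ _ ok smp arr chain.
- by exists 2%N; [lia | rewrite (smp 0%N 2%N) //; [lia | exact: A2odd_affine]].
- exists m; first by lia.
  have D1 : dn 1%N = (2 * dn 0)%N by apply: arr (D2_affine ok); lia.
  have Dm : dn m.-1 = (2 * dn m)%N by apply: arr (D2_arrow ok); lia.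
  have := chain 1%N m.-1 (leq_pred m) (@D2_chain m) 1%N m.-1; lia.
- by exists 1%N => //; rewrite (smp 0%N 1%N).
- by exists 1%N => //; rewrite (smp 0%N 1%N).
Qed.

Hypothesis Pj : P j.

(** A step along a_{kl} = -1 leads to a node that is not longer. The length hypothesis places j on
    the long side of each arrow, so arrows are only crossed from long to short. *)
Lemma propagate_untwisted : twist X = 1%N ->
  (forall k, (1 <= k <= rank X)%N -> (dn k <= dn j)%N) ->
  (forall k l, (1 <= k <= rank X)%N -> (1 <= l <= rank X)%N -> k != l ->
    nat_cartan X k l = -1 -> P k -> P l) ->
  forall k, (1 <= k <= rank X)%N -> P k.
Proof.
move=> untw long_j step.
have st1 k l : (1 <= k <= rank X)%N -> (1 <= l <= rank X)%N -> k != l ->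
    simple_pair X k l -> P k -> P l by move=> ? ? ? [? _]; apply: step.
have rev k l : simple_pair X k l -> simple_pair X l k by case.
move: (fun a b a1 bn => @spread_chain X P a b a1 bn st1) (dn_arrow dn_sym) (dn_chain dn_sym).
move: rev (dn_simple dn_sym) st1 untw okX jn dn_gt0 long_j step.
case: X => [m|m|m|m| | | | | |m|m|m| |] //= rev smp st1 _ ok jm dpos lng st chain arr dch k km.
- by apply: (chain 1%N m _ _ _ j k) => // i im; apply: A1_chain.
- have ch := chain 1%N m.-1 isT (leq_pred m) (@B1_chain m).
  have e := B1_arrow ok; have E : dn m.-1 = (2 * dn m)%N by apply: arr e; lia.
  have jneq : j != m.
    by apply/eqP => jE; have := lng m.-1; have := dpos m; rewrite jE; lia.
  have Pm : P m.-1 by apply: (ch j) => //; lia.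
  have [->|km'] : k = m \/ (k <= m.-1)%N by lia.
    by apply: (st m.-1) e.1 Pm; lia.
  by apply: (ch m.-1) Pm; lia.
(* In type C node m is the only long one, which forces j = m. *)
- have ch := chain 1%N m.-1 isT (leq_pred m) (@C1_chain m).
  have e := C1_arrow ok; have E : dn m = (2 * dn m.-1)%N by apply: arr e; lia.
  have jE : j = m.
    have [//|jm'] : j = m \/ (j <= m.-1)%N by lia.
    have := dch 1%N m.-1 (leq_pred m) (@C1_chain m) j m.-1.
    by have := lng m; have := dpos m; lia.
  have Pm : P m.-1 by move: Pj; rewrite jE => Pj'; apply: (st m) e.1 Pj'; lia.
  have [->|km'] : k = m \/ (k <= m.-1)%N by lia.
    by rewrite -jE.
  by apply: (ch m.-1) Pm; lia.
- have ch := chain 1%N m.-1 isT (leq_pred m) (@D1_chain m).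
  have e := D1_fork ok.
  have Pm : P m.-2.
    have [jE|jm'] : j = m \/ (j <= m.-1)%N by lia.
      by move: Pj; rewrite jE => Pj'; apply: (st1 m) (rev _ _ e) Pj'; lia.
    by apply: (ch j) => //; lia.
  have [->|km'] : k = m \/ (k <= m.-1)%N by lia.
    by apply: (st1 m.-2) e Pm; lia.
  by apply: (ch m.-2) Pm; lia.
- have ch := chain 1%N 5%N isT isT E61_chain; have e : simple_pair E61 3 6 by [].
  have P3 : P 3%N.
    have [jE|jm'] : j = 6%N \/ (j <= 5)%N by lia.
      by move: Pj; rewrite jE => Pj'; apply: (st1 6%N) (rev _ _ e) Pj'.
    by apply: (ch j) => //; lia.
  have [->|km'] : k = 6%N \/ (k <= 5)%N by lia.
    by apply: (st1 3%N) e P3.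
  by apply: (ch 3%N) P3; lia.
- have ch := chain 1%N 6%N isT isT E71_chain; have e : simple_pair E71 3 7 by [].
  have P3 : P 3%N.
    have [jE|jm'] : j = 7%N \/ (j <= 6)%N by lia.
      by move: Pj; rewrite jE => Pj'; apply: (st1 7%N) (rev _ _ e) Pj'.
    by apply: (ch j) => //; lia.
  have [->|km'] : k = 7%N \/ (k <= 6)%N by lia.
    by apply: (st1 3%N) e P3.
  by apply: (ch 3%N) P3; lia.
- have ch := chain 1%N 7%N isT isT E81_chain; have e : simple_pair E81 5 8 by [].
  have P5 : P 5%N.
    have [jE|jm'] : j = 8%N \/ (j <= 7)%N by lia.
      by move: Pj; rewrite jE => Pj'; apply: (st1 8%N) (rev _ _ e) Pj'.
    by apply: (ch j) => //; lia.
  have [->|km'] : k = 8%N \/ (k <= 7)%N by lia.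
    by apply: (st1 5%N) e P5.
  by apply: (ch 5%N) P5; lia.
- have e12 : simple_pair F1 1 2 by []; have e34 : simple_pair F1 3 4 by [].
  have e23 : arrow_pair F1 2 2 3 by [].
  have D23 := arr 2%N 2%N 3%N isT isT e23; have D34 := smp 3%N 4%N isT isT e34.
  have P2 : P 2%N.
    have [jE|[jE|jE]] : j = 1%N \/ j = 2%N \/ (3 <= j <= 4)%N by lia.
    - by move: Pj; rewrite jE => Pj'; apply: (st1 1%N) e12 Pj'.
    - by rewrite -jE.
    - have : j = 3%N \/ j = 4%N by lia.
      have := lng 2%N isT; have := dpos 3%N isT.
      by move=> d3 d2 [] j34; move: d2; rewrite j34; lia.
  have P3 : P 3%N by apply: (st 2%N) e23.1 P2.
  have [->|[->|[->|->]]] : k = 1%N \/ k = 2%N \/ k = 3%N \/ k = 4%N by lia.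
  - exact: (st1 2%N) (rev _ _ e12) P2.
  - by [].
  - by [].
  - exact: (st1 3%N) e34 P3.
- have e12 : arrow_pair G1 3 1 2 by [].
  have D12 := arr 3%N 1%N 2%N isT isT e12.
  have P1 : P 1%N.
    have [<- //|jE] : j = 1%N \/ j = 2%N by lia.
    by have := lng 1%N isT; have := dpos 2%N isT; rewrite jE; lia.
  have [->//|->] : k = 1%N \/ k = 2%N by lia.
  exact: (st 1%N) e12.1 P1.
Qed.

(** Dual to the untwisted case: j is on the short side of each arrow, and arrows are crossed from
    short to long. *)
Lemma propagate_twisted : twist X <> 1%N -> ~~ is_A2even X ->
  (forall k, (1 <= k <= rank X)%N -> (dn j <= dn k)%N) ->
  (forall k l (p : nat), (1 <= k <= rank X)%N -> (1 <= l <= rank X)%N -> k != l ->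
    (1 <= p <= 3)%N -> arrow_pair X p l k -> P k -> P l) ->
  forall k, (1 <= k <= rank X)%N -> P k.
Proof.
move=> tw nA short_j step.
have st1 k l : (1 <= k <= rank X)%N -> (1 <= l <= rank X)%N -> k != l ->
    simple_pair X k l -> P k -> P l.
  by move=> kn ln kl [e1 e2]; apply: (step k l 1%N).
have rev k l : simple_pair X k l -> simple_pair X l k by case.
move: (fun a b a1 bn => @spread_chain X P a b a1 bn st1) (dn_arrow dn_sym) (dn_chain dn_sym).
move: rev (dn_simple dn_sym) st1 tw nA okX jn dn_gt0 short_j step.
case: X => [m|m|m|m| | | | | |m|m|m| |] //= rev smp st1 _ _ ok jm dpos shj st chain arr dch k km.
- have ch := chain 1%N m.-1 isT (leq_pred m) (@A2odd_chain m).
  have e := A2odd_arrow ok; have E : dn m = (2 * dn m.-1)%N by apply: arr e; lia.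
  have jneq : j != m.
    by apply/eqP => jE; have := shj m.-1; have := dpos m; rewrite jE; lia.
  have Pm : P m.-1 by apply: (ch j) => //; lia.
  have [->|km'] : k = m \/ (k <= m.-1)%N by lia.
    by apply: (st m.-1 m 2%N) e Pm; lia.
  by apply: (ch m.-1) Pm; lia.
(* Here node m is the only short finite node, which forces j = m. *)
- have ch := chain 1%N m.-1 isT (leq_pred m) (@D2_chain m).
  have e := D2_arrow ok; have E : dn m.-1 = (2 * dn m)%N by apply: arr e; lia.
  have jE : j = m.
    have [//|jm'] : j = m \/ (j <= m.-1)%N by lia.
    have := dch 1%N m.-1 (leq_pred m) (@D2_chain m) j m.-1.
    by have := shj m; have := dpos m; lia.
  have Pm : P m.-1 by move: Pj; rewrite jE => Pj'; apply: (st m _ 2%N) e Pj'; lia.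
  have [->|km'] : k = m \/ (k <= m.-1)%N by lia.
    by rewrite -jE.
  by apply: (ch m.-1) Pm; lia.
- have e12 : simple_pair E2 1 2 by []; have e34 : simple_pair E2 3 4 by [].
  have e23 : arrow_pair E2 2 3 2 by [].
  have D23 := arr 2%N 3%N 2%N isT isT e23; have D34 := smp 3%N 4%N isT isT e34.
  have P2 : P 2%N.
    have [jE|[jE|jE]] : j = 1%N \/ j = 2%N \/ (3 <= j <= 4)%N by lia.
    - by move: Pj; rewrite jE => Pj'; apply: (st1 1%N) e12 Pj'.
    - by rewrite -jE.
    - have : j = 3%N \/ j = 4%N by lia.
      have := shj 2%N isT; have := dpos 2%N isT.
      by move=> d3 d2 [] j34; move: d2; rewrite j34; lia.
  have P3 : P 3%N by apply: (st 2%N _ 2%N) e23 P2.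
  have [->|[->|[->|->]]] : k = 1%N \/ k = 2%N \/ k = 3%N \/ k = 4%N by lia.
  - exact: (st1 2%N) (rev _ _ e12) P2.
  - by [].
  - by [].
  - exact: (st1 3%N) e34 P3.
- have e12 : arrow_pair D3 3 2 1 by [].
  have D12 := arr 3%N 2%N 1%N isT isT e12.
  have P1 : P 1%N.
    have [<- //|jE] : j = 1%N \/ j = 2%N by lia.
    by have := shj 1%N isT; have := dpos 1%N isT; rewrite jE; lia.
  have [->//|->] : k = 1%N \/ k = 2%N by lia.
  exact: (st 1%N _ 3%N) e12 P1.
Qed.

End Propagation.

Lemma propagate_A2even m (P : nat -> Prop) : P 2%N ->
  (forall k l, (2 <= k <= m)%N -> (2 <= l <= m)%N -> k != l ->
    simple_pair (A2even m) k l -> P k -> P l) ->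
  forall k, (2 <= k <= m)%N -> P k.
Proof.
move=> P2 step k km; apply: (@chain_spread P 2%N m _ _ 2%N) => // [i im|i im|]; last by lia.
  by apply: step (A2even_chain im); lia.
by have [e1 e2] := A2even_chain im; apply: step; rewrite // ; lia.
Qed.

(** * Comparison of the two integral forms *)

Lemma gen_zsubalg_ring (U : algType rat) (S : set U) : subring_closed [in gen_zsubalg S].
Proof.
split=> [|u v|u v].
- by rewrite in_setE => B [[B1 _ _] _]; rewrite in_setE in B1.
- rewrite !in_setE => Su Sv B [[B1 BB BM] SB].
  have := BB u v; rewrite !in_setE; apply; first exact: Su.
  exact: Sv.
- rewrite !in_setE => Su Sv B [[B1 BB BM] SB].
  have := BM u v; rewrite !in_setE; apply; first exact: Su.
  exact: Sv.
Qed.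

Lemma exp_adZ (L : lieAlgType rat) (x z : L) k :
  ad_nilpotent x z -> exp_ad x (k *: z) = k *: exp_ad x z.
Proof.
move=> [N zN]; rewrite (exp_ad_sum zN) (@exp_ad_sum _ _ _ N) ?iter_lieZ ?zN ?scaler0 //.
by rewrite scaler_sumr; apply: eq_bigr => m _; rewrite iter_lieZ !scalerA mulrC.
Qed.

Lemma fnodeE n (i : 'I_n) : fnode i = i.+1 :> nat.
Proof. exact: lift0. Qed.

Lemma fnode_val_inj n (i i' : 'I_n) : fnode i = fnode i' :> nat -> i = i'.
Proof. by rewrite !fnodeE => -[] /val_inj. Qed.

Lemma fnode_surj n k : (1 <= k <= n)%N -> exists i : 'I_n, fnode i = k :> nat.
Proof.
case: k => // k kn; exists (Ordinal (kn : (k < n)%N)); exact: fnodeE.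
Qed.

Lemma fnode_neq n (i j : 'I_n) : (fnode i : nat) != fnode j -> i != j.
Proof. by apply: contraNN => /eqP ->. Qed.

(** * Integrality under the automorphisms tau_i and their inverses *)

Section Tau.
Variables (n : nat) (L : lieAlgType rat) (U : algType rat) (iota : L -> U).
Hypothesis iota_hom : lie_to_alg_hom iota.
Variable B : set U.
Hypothesis B_ring : subring_closed [in B].
Variables (y : drinfeld_gen n -> L) (i : 'I_n).
Hypothesis y_int : forall u, integral iota B (y (Dx u i 0)).

Lemma integral_tau z : integral iota B z -> integral iota B (tau y i z).
Proof.
move=> zB; do !apply: (integral_exp_ad iota_hom B_ring) => //.
exact: (divpow_integralN iota_hom B_ring).
Qed.

Hypothesis y_nil : forall u z, ad_nilpotent (y (Dx u i 0)) z.

Let y_nilN u z : ad_nilpotent (- y (Dx u i 0)) z.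
Proof. by have [N zN] := y_nil u z; exists N; rewrite iter_lieN zN scaler0. Qed.

(** The three exponentials are undone one at a time; this uses nilpotency of the ad-actions on every
    vector, since the intermediate ones are arbitrary. *)
Lemma integral_tau_inv z : integral iota B (tau y i z) -> integral iota B z.
Proof.
have inv x : integral iota B x -> (forall z, ad_nilpotent x z) ->
    forall z, integral iota B (exp_ad x z) -> integral iota B z.
  move=> xB x_nil v; have [N vN] := x_nil v.
  exact: (integral_exp_ad_inv iota_hom B_ring vN).
move=> H; apply: (inv _ (y_int false) (y_nil _)).
apply: (inv (- y (Dx true i 0))) => //; first exact: divpow_integralN.
exact: (inv _ (y_int false) (y_nil _)).
Qed.

Lemma tauZ k z : tau y i (k *: z) = k *: tau y i z.
Proof. by rewrite /tau !exp_adZ. Qed.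

End Tau.

(** * The two forms under the identification of the presentations *)

Section Main.
Variables (X : affine_type) (okX : affine_ok X).
Variables (d : 'I_(rank X).+1 -> nat) (hd : min_symmetrizer (cartan X) d).
Variables (L : lieAlgType rat) (g : km_gen (rank X) -> L).
Hypothesis hKM : presents (@km_relations X) g.
Variable y : drinfeld_gen (rank X) -> L.
Hypothesis rel : drinfeld_relations d y.
Variables (theta : 'rV[int]_(rank X)) (htheta : is_theta d theta).
Variables (w : seq 'I_(rank X)) (j : 'I_(rank X)).
Hypothesis hw : theta = foldr (@simple_refl X) (simple_root j) w.
Hypothesis hj : is_A2even X -> fnode j = 1%N :> nat.
Hypothesis hid : identified g y w j.
Variables (U : algType rat) (iota : L -> U) (iota_hom : lie_to_alg_hom iota).

Let x u i r := y (Dx u i r).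
Let BK := UZ_KM iota g.
Let BD := UZ_Drinfeld d iota y.
Let BK_ring : subring_closed [in BK] := gen_zsubalg_ring _.
Let BD_ring : subring_closed [in BD] := gen_zsubalg_ring _.
Let G := integral iota BK.

Lemma integral_KM i : G (g (KMe i)) /\ G (g (KMf i)).
Proof.
by split=> m; apply: sub_gen_smallest; exists i, m; [left | right].
Qed.

Lemma integral_x0 u i : G (x u i 0).
Proof.
case: hid => He Hf _; have [Ge Gf] := integral_KM (fnode i).
by case: u; rewrite /x -?He -?Hf.
Qed.

Lemma x0_nilpotent u i z : ad_nilpotent (x u i 0) z.
Proof.
case: hid => He Hf _; have [Ne Nf] := km_ad_nilpotent hKM (fnode i) z.
by case: u; rewrite /x -?He -?Hf.
Qed.

Lemma integral_foldr_tau z : G (foldr (tau y) z w) -> G z.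
Proof.
elim: w => //= i w' IH H; apply: IH.
apply: (integral_tau_inv iota_hom BK_ring _ _ H) => [u|u v]; first exact: integral_x0.
exact: x0_nilpotent.
Qed.

(** Lets the factor 4^-1 of type A_{2n}^(2) pass inside the tau_i before these are undone. *)
Lemma foldr_tauZ k z : foldr (tau y) (k *: z) w = k *: foldr (tau y) z w.
Proof.
by elim: w => //= i w' ->; rewrite tauZ // => *; exact: x0_nilpotent.
Qed.

Let dn k := d (inord k).
Let dn_fnode i : dn (fnode i) = d (fnode i).
Proof. by rewrite /dn inord_val. Qed.

Lemma dn_positive k : (k <= rank X)%N -> (0 < dn k)%N.
Proof. by move=> _; case: hd => _ + _; apply. Qed.

Lemma dn_symmetric k l : (k <= rank X)%N -> (l <= rank X)%N ->
  (dn k)%:Z * nat_cartan X k l = (dn l)%:Z * nat_cartan X l k.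
Proof.
move=> kn ln; case: hd => sym _ _; have := sym (inord k) (inord l).
by rewrite !cartan_nat !inordK.
Qed.

Lemma dn_one : exists2 k, (k <= rank X)%N & dn k = 1%N.
Proof.
by case: hd => _ _ [i di]; exists i; [rewrite -ltnS | rewrite /dn inord_val].
Qed.

Let all_in i := forall v m, drinfeld_deg d i m -> G (x v i m).
Let P k := forall i, fnode i = k :> nat -> all_in i.

Let G_opp z : G z -> G (- z) := @divpow_integralN L U iota iota_hom BK BK_ring z.
Let G_refl := integral_reflection iota_hom BK_ring.

Let jn : (1 <= fnode j <= rank X)%N.
Proof. by rewrite fnodeE ltn_ord. Qed.

(** The first hypothesis ensures that the source node k is not special. *)
Lemma pair_spread k l : ~~ is_A2even X \/ (2 <= k)%N && (dn k == 2)%N ->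
  (1 <= k <= rank X)%N -> (1 <= l <= rank X)%N -> k != l ->
  nat_cartan X k l = -1 -> (forall i i', fnode i = l :> nat -> fnode i' = k :> nat ->
     dtilde d i = dtilde d i') -> P k -> P l.
Proof.
move=> nsp kn ln kl akl dt Pk i il; have [i' i'k] := fnode_surj kn.
have dtE := dt _ _ il i'k.
apply: (spread1 rel G_opp G_refl _ _ _ dtE (Pk _ i'k)).
- by apply: fnode_neq; rewrite il i'k eq_sym.
- case: nsp => [nA|/andP[_ /eqP dk]]; first by rewrite /special_node (negPf nA).
  by rewrite /special_node negb_and -dn_fnode i'k dk orbT.
- by rewrite cartan_nat il i'k.
- by move=> u; apply: integral_x0.
Qed.

Lemma integral_Drinfeld_generic : ~~ is_A2even X -> dtilde d j = 1%N -> all_in j.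
Proof.
move=> nA dj v m _; have [_ _] := hid; rewrite (negPf nA) => -[E0 F0].
have := integral_KM ord0; rewrite E0 F0 => -[Ge Gf].
apply: (rank1_nonspecial rel G_opp G_refl) => //.
- by rewrite /special_node (negPf nA).
- by move=> u; apply: integral_x0.
- exact: integral_foldr_tau Ge.
- exact: integral_foldr_tau Gf.
Qed.

Lemma P_start : all_in j -> P (fnode j).
Proof. by move=> Gj i /fnode_val_inj ->. Qed.

Lemma P_all : (forall k, (1 <= k <= rank X)%N -> P k) -> forall i, all_in i.
Proof. by move=> PP i; apply: (PP (fnode i)) => //; rewrite fnodeE ltn_ord. Qed.

Lemma integral_untwisted : twist X = 1%N -> forall i, all_in i.
Proof.
move=> tw; have nA : ~~ is_A2even X by case: X tw.
have dt i : dtilde d i = 1%N by rewrite /dtilde tw eqxx.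
apply: P_all; apply: (propagate_untwisted okX dn_positive dn_symmetric jn) => //.
- by apply: P_start; apply: integral_Drinfeld_generic.
- move=> k /fnode_surj[i <-]; rewrite !dn_fnode; apply: (long_theta hd _ hw).
  by move: htheta; rewrite /is_theta tw eqxx.
- move=> k l kn ln kl akl; apply: pair_spread => //; first by left.
  by move=> *; rewrite !dt.
Qed.

Lemma integral_twisted : twist X <> 1%N -> ~~ is_A2even X -> forall i, all_in i.
Proof.
move=> tw nA; have dt i : dtilde d i = dn (fnode i).
  by rewrite /dtilde (negPf nA) orbF dn_fnode; case: eqP tw.
have short_j k : (1 <= k <= rank X)%N -> (dn (fnode j) <= dn k)%N.
  move=> /fnode_surj[i <-]; rewrite !dn_fnode; apply: (short_theta hd _ hw).
  by move: htheta; rewrite /is_theta; case: eqP tw.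
have dj : dtilde d j = 1%N.
  by rewrite dt (affine_short_node okX dn_positive dn_symmetric jn tw nA short_j dn_one).
apply: P_all; apply: (propagate_twisted okX dn_positive dn_symmetric jn) => //.
  by apply: P_start; apply: integral_Drinfeld_generic.
move=> k l p kn ln kl p3 e.
have dkl : dn l = (p * dn k)%N by apply: (dn_arrow dn_symmetric) e; lia.
case: e => alk akl.
have [p1|p2] : p = 1%N \/ (2 <= p)%N by lia.
  rewrite p1 in akl dkl; apply: pair_spread => //; first by left.
  by move=> i i' il i'k; rewrite !dt il i'k dkl mul1n.
move=> Pk i il; have [i' i'k] := fnode_surj kn.
(* In [spread_crossing] the Cartan entry is written -(p + 1), hence the predecessor. *)
apply: (spread_crossing rel G_opp G_refl (j := i') (p := p.-1)).
- by apply: fnode_neq; rewrite il i'k eq_sym.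
- by rewrite /special_node (negPf nA).
- lia.
- by rewrite cartan_nat il i'k akl; lia.
- by rewrite !dt il i'k dkl; congr (_ * _)%N; lia.
- by rewrite dt i'k; apply: dn_positive; lia.
- exact: Pk.
- by move=> u; apply: integral_x0.
Qed.

Lemma integral_A2even : is_A2even X -> forall i, all_in i.
Proof.
move=> A; have [d1 d2] := A2even_symmetrizer dn_symmetric okX A dn_one.
have dt i : dtilde d i = 1%N by rewrite /dtilde A orbT.
have j1 := hj A.
have sp : special_node d j by rewrite /special_node A -dn_fnode j1 d1.
have [e1 e2] : G (4^-1 *: ⟦x true j 0, x true j 1⟧) /\
               G (4^-1 *: ⟦x false j 0, x false j (-1)⟧).
  have [_ _] := hid; rewrite A => -[s1 [s2 [E1 E2]]].
  (* The scalar is split into a sign, which integrality ignores, and 4^-1, which is moved onto the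
     bracket. *)
  have [Ge Gf] := integral_KM ord0; rewrite E1 -scalerA -foldr_tauZ in Ge.
  rewrite E2 -scalerA -foldr_tauZ in Gf.
  split; apply: integral_foldr_tau; [move: Ge | move: Gf];
    exact: (integral_sign iota_hom BK_ring).
have [GY Gj] := rank1_special rel G_opp G_refl sp j1 (fun v => integral_x0 v j) e1 e2.
apply: P_all => k kn.
have [k1|k2] : k = 1%N \/ (2 <= k)%N by lia.
  by rewrite k1 -j1; apply: P_start.
(* Leaving node 1 requires the long root vectors; beyond node 2 all remaining edges are simple. *)
have P2 : P 2%N.
  move=> i i2; have ji : i != j by apply: fnode_neq; rewrite i2 j1.
  apply: (spread_special_all rel G_opp G_refl sp j1 ji) => // [|v|v].
  - rewrite cartan_nat j1 i2; move: A kn k2 {i2 ji}; case: X => // m _ kn k2.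
    have m2 : (2 <= m)%N by case/andP: kn => _; exact: leq_trans.
    by have [_] := A2even_arrow m2.
  - exact: integral_x0.
  - exact: integral_x0.
have n2 : (1 <= 2 <= rank X)%N by lia.
have XE : X = A2even (rank X) by move: A; case: X.
apply: (propagate_A2even (m := rank X) P2) => // [k' l kn' ln' kl|]; last lia.
rewrite -XE => e; apply: pair_spread => //; try lia.
- by right; rewrite d2 // eqxx andbT; lia.
- by case: e.
- by move=> *; rewrite !dt.
Qed.

Lemma integral_Drinfeld i : all_in i.
Proof.
case: (boolP (is_A2even X)) => A; first exact: integral_A2even.
have [tw|tw] := eqVneq (twist X) 1%N; first exact: integral_untwisted.
by apply: integral_twisted => //; apply/eqP.
Qed.

Lemma UZ_Drinfeld_sub : BD `<=` BK.
Proof.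
apply: smallest_sub; first exact: BK_ring.
by move=> _ [u [i [r [m [ir ->]]]]]; apply: integral_Drinfeld.
Qed.

Lemma integral_x u i r : integral iota BD (x u i r).
Proof.
have [ir m|nir] := boolP (drinfeld_deg d i r).
  by apply: sub_gen_smallest; exists u, i, r, m.
have -> : x u i r = 0 by case: rel => + _; apply.
exact: (divpow_integral0 iota_hom BD_ring).
Qed.

(** Outside type A_{2n}^(2), e_0 and f_0 are images under the tau_i of Drinfeld generators
    themselves, rather than of quarters of brackets. *)
Lemma UZ_KM_sub : ~~ is_A2even X -> BK `<=` BD.
Proof.
move=> nA; have [He Hf] := hid; rewrite (negPf nA) => -[E0 F0].
have tauB z : integral iota BD z -> integral iota BD (foldr (tau y) z w).
  move=> zB; elim: w => //= i w' IH; apply: (integral_tau iota_hom BD_ring) => // u.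
  exact: integral_x.
apply: smallest_sub; first exact: BD_ring.
have gens i : integral iota BD (g (KMe i)) /\ integral iota BD (g (KMf i)).
  have [i' ->|->] := unliftP ord0 i; last first.
    by rewrite E0 F0; split; apply: tauB; apply: integral_x.
  by rewrite -/(fnode i') He Hf; split; apply: integral_x.
by move=> _ [i [m [->|->]]]; case: (gens i).
Qed.

End Main.

Theorem theorem33 (X : affine_type) (hX : affine_ok X)
    (d : 'I_(rank X).+1 -> nat) (hd : min_symmetrizer (cartan X) d)
    (L : lieAlgType rat)
    (g : km_gen (rank X) -> L) (hKM : presents (@km_relations X) g)
    (y : drinfeld_gen (rank X) -> L) (hDr : presents (@drinfeld_relations X d) y)
    (theta : 'rV[int]_(rank X)) (htheta : is_theta d theta)
    (w : seq 'I_(rank X)) (j : 'I_(rank X))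
    (hw : theta = foldr (@simple_refl X) (simple_root j) w)
    (hj : is_A2even X -> fnode j = 1%N :> nat)
    (hid : identified g y w j)
    (U : algType rat) (iota : L -> U) (hU : is_enveloping iota) :
  (~~ is_A2even X -> UZ_Drinfeld d iota y = UZ_KM iota g) /\
  (is_A2even X -> UZ_Drinfeld d iota y `<=` UZ_KM iota g).
Proof.
case: hDr => rel _; case: hU => iota_hom _.
have DK := UZ_Drinfeld_sub hX hd hKM rel htheta hw hj hid iota_hom.
split=> // nA; apply/seteqP; split=> //.
exact: (UZ_KM_sub rel hid iota_hom nA).
Qed.
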